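(* Let $\Phi$ be a sharp tridiagonal system over a field $\mathbb F$, and let $P\in\mathbb F[\lambda]$ be its Drinfel'd polynomial. Then $P$ is $D_4$-invariant; that is, all the relatives of $\Phi$ (the tridiagonal systems obtained from $\Phi$ by repeatedly applying the operations $*,\downarrow,\Downarrow$) have the same Drinfel'd polynomial $P$.
   Context: Let $\mathbb F$ be a field, $\overline{\mathbb F}$ its algebraic closure, $V$ a vector space over $\mathbb F$ of finite positive dimension. A tridiagonal pair on $V$ is an ordered pair of $\mathbb F$-linear maps $A,A^*:V\to V$ ($A^*$ is just a name, not an adjoint) such that: (i) both are diagonalizable; (ii) the eigenspaces of $A$ can be ordered $V_0,\dots,V_d$ with $A^*V_i\subseteq V_{i-1}+V_i+V_{i+1}$ ($0\le i\le d$, $V_{-1}=V_{d+1}=0$); (iii) the eigenspaces of $A^*$ can be ordered $V^*_0,\dots,V^*_\delta$ with $AV^*_i\subseteq V^*_{i-1}+V^*_i+V^*_{i+1}$ ($0\le i\le\delta$, $V^*_{-1}=V^*_{\delta+1}=0$); (iv) no subspace $W\ne 0,V$ satisfies $AW\subseteq W$ and $A^*W\subseteq W$. It is known that $d=\delta$ (the diameter) and $\dim V_i=\dim V^*_i=\dim V_{d-i}$. Orderings as in (ii), (iii) are called standard. The pair is sharp if $\dim V_0=1$. A tridiagonal system is a sequence $\Phi=(A;\{E_i\}_{i=0}^d;A^*;\{E^*_i\}_{i=0}^d)$ where $A,A^*$ is a tridiagonal pair and, for standard orderings of the eigenspaces, $E_i$ (resp. $E^*_i$) is the projection onto $V_i$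 (resp. $V^*_i$) along the sum of the other eigenspaces. $\Phi$ is sharp if $A,A^*$ is. Let $\theta_i$ (resp. $\theta^*_i$) be the eigenvalue of $A$ on $E_iV$ (resp. of $A^*$ on $E^*_iV$). When $\Phi$ is sharp, $E^*_0V$ is one-dimensional and is known to be invariant under $(A^*-\theta^*_1I)\cdots(A^*-\theta^*_iI)(A-\theta_{i-1}I)\cdots(A-\theta_0I)$ for $0\le i\le d$; $\zeta_i$ denotes the corresponding eigenvalue ($\zeta_0=1$). Operations: $\Phi^*=(A^*;\{E^*_i\};A;\{E_i\})$, $\Phi^\downarrow=(A;\{E_i\};A^*;\{E^*_{d-i}\})$, $\Phi^\Downarrow=(A;\{E_{d-i}\};A^*;\{E^*_i\})$. These are again (sharp) tridiagonal systems, and the operations generate an action of the dihedral group $D_4$ of order 8. Base $\beta\in\mathbb F$: if $d\ge3$, the expressions $\frac{\theta_{i-2}-\theta_{i+1}}{\theta_{i-1}-\theta_i}$, $\frac{\theta^*_{i-2}-\theta^*_{i+1}}{\theta^*_{i-1}-\theta^*_i}$ are known to be equal and independent of $i$ for $2\le i\le d-1$, and $\beta+1$ is their common value; if $d\le2$, $\beta$ is any fixed nonzero scalar in $\mathbb F$ (the same one for all relatives of $\Phi$). Type: I if $\beta\ne\pm2$; II if $\beta=2$, $\mathrm{Char}(\mathbb F)\ne2$; III$^+$ (resp. III$^-$) if $\beta=-2$, $\mathrm{Char}(\mathbb F)\neq2$, $d$ even (resp. odd); IV if $\beta=0$, $\mathrm{Char}(\mathbb F)=2$ (then $d=3$). Drinfel'd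 polynomial, type not III$^+$: $P=\sum_{i=0}^d\zeta_i\,p_{i+1}p_{i+2}\cdots p_d$, where for $1\le i\le d$, $p_i=(\theta_0\theta^*_d+\theta_d\theta^*_0-\lambda)\alpha_i+(\theta_0-\theta_i)(\theta^*_0-\theta^*_i)$ and: type I: $\alpha_i=\frac{(q^i-q^{-i})^2}{(q^d-q^{-d})^2}$ with $q\in\overline{\mathbb F}$ nonzero, $q^2+q^{-2}=\beta$ (it is known that $q^{2i}\ne1$ for $1\le i\le d$); type II: $\alpha_i=i^2/d^2$; types III$^-$ and IV: $\alpha_i=0$ for $i$ even and $\alpha_i=1$ for $i$ odd. Drinfel'd polynomial, type III$^+$: $P=p_1p_2\cdots p_d$, where $p_i=(\theta_0\theta^*_d+\theta_d\theta^*_0-\lambda)i^2/d^2+(\theta_0-\theta_i)(\theta^*_0-\theta^*_i)$ for $i$ even, $p_i=\theta_0\theta^*_d+\theta_d\theta^*_0-\lambda$ for $i$ odd ($P=1$ if $d=0$). *)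

(* Defs.v *)
From HB Require Import structures.
From mathcomp Require Import all_boot all_order all_algebra.

Set Implicit Arguments.
Unset Strict Implicit.
Unset Printing Implicit Defensive.

Import GRing.Theory.
Local Open Scope ring_scope.

Section TridiagonalPairs.

Variables (F : fieldType) (V : vectType F).

Definition diagonalizable_lfun (A : 'End(V)) : Prop :=
  exists2 X : seq V, basis_of fullv X
    & forall v, v \in X -> exists a : F, A v = a *: v.

Definition eigenspace_ordering (A : 'End(V)) d (W : 'I_d.+1 -> {vspace V})
    : Prop :=
  [/\ injective W,
      forall i, exists2 a : F,
        passmx.leigenvalue A a & W i = passmx.leigenspace A a
    & forall a : F, passmx.leigenvalue A a ->
        exists i, W i = passmx.leigenspace A a].

(* The sum below ranges over the j with |i - j| <= 1, so the conventions
   V_{-1} = V_{d+1} = 0 are built in. *)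
Definition standard_ordering (A As : 'End(V)) d (W : 'I_d.+1 -> {vspace V})
    : Prop :=
  eigenspace_ordering A W /\
  forall i : 'I_d.+1,
    (As @: W i <= \sum_(j < d.+1 | (j <= i.+1)%N && (i <= j.+1)%N) W j)%VS.

Definition tridiagonal_pair (A As : 'End(V)) : Prop :=
  [/\ diagonalizable_lfun A /\ diagonalizable_lfun As,
      exists d (W : 'I_d.+1 -> {vspace V}), standard_ordering A As W,
      exists delta (Ws : 'I_delta.+1 -> {vspace V}), standard_ordering As A Ws
    & forall U : {vspace V}, (A @: U <= U)%VS -> (As @: U <= U)%VS ->
        U = 0%VS \/ U = fullv].

Record td_seq (d : nat) := TDSeq {
  td_A : 'End(V);
  td_E : 'I_d.+1 -> 'End(V);
  td_As : 'End(V);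
  td_Es : 'I_d.+1 -> 'End(V)
}.

Definition projections_onto d (W : 'I_d.+1 -> {vspace V})
    (E : 'I_d.+1 -> 'End(V)) : Prop :=
  forall i, E i = daddv_pi (W i) (\sum_(j < d.+1 | j != i) W j)%VS.

Definition tridiagonal_system d (Phi : td_seq d) : Prop :=
  tridiagonal_pair (td_A Phi) (td_As Phi) /\
  exists W Ws : 'I_d.+1 -> {vspace V},
    [/\ standard_ordering (td_A Phi) (td_As Phi) W,
        standard_ordering (td_As Phi) (td_A Phi) Ws,
        projections_onto W (td_E Phi)
      & projections_onto Ws (td_Es Phi)].

Definition sharp d (Phi : td_seq d) : Prop :=
  \dim (limg (td_E Phi ord0)) = 1%N.

Definition td_star d (Phi : td_seq d) : td_seq d :=
  TDSeq (td_As Phi) (td_Es Phi) (td_A Phi) (td_E Phi).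

Definition td_down d (Phi : td_seq d) : td_seq d :=
  TDSeq (td_A Phi) (td_E Phi) (td_As Phi) (fun i => td_Es Phi (rev_ord i)).

Definition td_Down d (Phi : td_seq d) : td_seq d :=
  TDSeq (td_A Phi) (fun i => td_E Phi (rev_ord i)) (td_As Phi) (td_Es Phi).

Inductive relative d (Phi : td_seq d) : td_seq d -> Prop :=
| relative_refl : relative Phi Phi
| relative_star Psi : relative Phi Psi -> relative Phi (td_star Psi)
| relative_down Psi : relative Phi Psi -> relative Phi (td_down Psi)
| relative_Down Psi : relative Phi Psi -> relative Phi (td_Down Psi).

(* The scalar by which f acts on U, read off on a chosen nonzero vector of U;
   meaningful only when U <> 0 and f acts on U as a scalar (eigval_onE). *)
Definition eigval_on (f : 'End(V)) (U : {vspace V}) : F :=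
  coord [tuple vpick U] ord0 (f (vpick U)).

Lemma eigval_onE (f : 'End(V)) (U : {vspace V}) (c : F) :
  U != 0%VS -> (forall v, v \in U -> f v = c *: v) -> eigval_on f U = c.
Proof.
move=> U0 fU; rewrite /eigval_on fU ?memv_pick // linearZ /=.
have X_free : free [tuple vpick U] by rewrite seq1_free vpick0.
by have := coord_free ord0 ord0 X_free; rewrite /= => ->; rewrite mulr1.
Qed.

Section SystemScalars.

Variables (d : nat) (Phi : td_seq d).

(* Indices are natural numbers; inord is only used at indices <= d. *)
Definition theta (i : nat) : F :=
  eigval_on (td_A Phi) (limg (td_E Phi (inord i))).

Definition thetas (i : nat) : F :=
  eigval_on (td_As Phi) (limg (td_Es Phi (inord i))).

Definition comp_list (s : seq 'End(V)) : 'End(V) :=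
  foldr (fun f g => (f \o g)%VF) \1%VF s.

(* (A* - theta*_1) ... (A* - theta*_i) (A - theta_{i-1}) ... (A - theta_0),
   the rightmost factor being applied first. *)
Definition zeta_map (i : nat) : 'End(V) :=
  comp_list
    ([seq td_As Phi - thetas j *: \1%VF | j <- iota 1 i] ++
     [seq td_A Phi - theta j *: \1%VF | j <- rev (iota 0 i)]).

Definition zeta (i : nat) : F :=
  eigval_on (zeta_map i) (limg (td_Es Phi ord0)).

Definition is_base (beta : F) : Prop :=
  if (3 <= d)%N then
    forall i, (2 <= i <= d.-1)%N ->
      (theta (i - 2) - theta i.+1) / (theta i.-1 - theta i) = beta + 1 /\
      (thetas (i - 2) - thetas i.+1) / (thetas i.-1 - thetas i) = beta + 1
  else beta != 0.

End SystemScalars.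

End TridiagonalPairs.

Arguments eigval_on {F V} f U.

Inductive td_type := TypeI | TypeII | TypeIIIplus | TypeIIIminus | TypeIV.

(* In characteristic 2 one has 2 = -2 = 0, so there beta <> 0 is type I and
   beta = 0 is type IV. *)
Definition type_of (F : fieldType) (beta : F) (d : nat) : td_type :=
  if (beta != 2) && (beta != - 2) then TypeI
  else if 2%N \in [pchar F] then TypeIV
  else if beta == 2 then TypeII
  else if odd d then TypeIIIminus else TypeIIIplus.

Section DrinfeldPolynomial.

Variables (F : fieldType) (Fbar : closedFieldType).
Variable (iota : {rmorphism F -> Fbar}).

(* The values alpha_1, ..., alpha_d, as elements of F; in type I they are given
   by an expression in Fbar.  Type III^+ is treated separately. *)
Definition is_alpha (beta : F) (d : nat) (alpha : nat -> F) : Prop :=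
  match type_of beta d with
  | TypeI =>
      exists q : Fbar,
        [/\ q != 0, q ^+ 2 + q ^- 2 = iota beta
          & forall i, (1 <= i <= d)%N ->
              iota (alpha i) =
                (q ^+ i - q ^- i) ^+ 2 / (q ^+ d - q ^- d) ^+ 2]
  | TypeII =>
      forall i, (1 <= i <= d)%N -> alpha i = i%:R ^+ 2 / d%:R ^+ 2
  | TypeIIIminus | TypeIV =>
      forall i, (1 <= i <= d)%N -> alpha i = if odd i then 1 else 0
  | TypeIIIplus => False
  end.

Variables (V : vectType F) (d : nat).

(* theta_0 theta*_d + theta_d theta*_0 - lambda *)
Definition corner (Phi : td_seq V d) : {poly F} :=
  (theta Phi 0 * thetas Phi d + theta Phi d * thetas Phi 0)%:P - 'X.

Definition gap (Phi : td_seq V d) (i : nat) : {poly F} :=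
  ((theta Phi 0 - theta Phi i) * (thetas Phi 0 - thetas Phi i))%:P.

Definition p_factor (alpha : nat -> F) (Phi : td_seq V d) (i : nat)
    : {poly F} :=
  alpha i *: corner Phi + gap Phi i.

Definition p_factor_IIIplus (Phi : td_seq V d) (i : nat) : {poly F} :=
  if odd i then corner Phi
  else (i%:R ^+ 2 / d%:R ^+ 2) *: corner Phi + gap Phi i.

Definition is_drinfeld_poly (beta : F) (Phi : td_seq V d) (P : {poly F})
    : Prop :=
  is_base Phi beta /\
  match type_of beta d with
  | TypeIIIplus => P = \prod_(1 <= i < d.+1) p_factor_IIIplus Phi i
  | _ =>
      exists2 alpha : nat -> F, is_alpha beta d alpha
        & P = \sum_(0 <= i < d.+1)
                zeta Phi i *: \prod_(i.+1 <= j < d.+1) p_factor alpha Phi j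
  end.

End DrinfeldPolynomial.

(* Main.v *)
Require Import Defs.
From HB Require Import structures.
From mathcomp Require Import all_boot all_order all_algebra.
From mathcomp Require Import ring zify.

Set Implicit Arguments.
Unset Strict Implicit.
Unset Printing Implicit Defensive.

Import GRing.Theory.
Local Open Scope ring_scope.

(** Write th_i and ths_i for the eigenvalues of A and As (the second map of the
    pair), E_i and Es_i for the projections, tau_i(x) for
    (x - th_0) ... (x - th_(i-1)), and phi_i for the product of the
    ths_0 - ths_j over 1 <= j <= i.

    The sum formula for P is a linear functional of A seen from the line of
    Es_0. Since A is tridiagonal for the Es_j, tau_i(A) sends that line into the
    sum of the first i + 1 eigenspaces of As; the factors As - ths_1, ...,
    As - ths_i kill all of them but the first. Hence zeta_i is phi_i times the
    scalar of Es_0 tau_i(A) Es_0, that is, phi_i sum_k tau_i(th_k) m_k, where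
    Es_0 E_k Es_0 = m_k Es_0 ([zeta_spectral_mass]). So P = sum_k m_k S(k), where
    S(k) = sum_i phi_i tau_i(th_k) p_(i+1) ... p_d ([kernel]) involves only the
    eigenvalues.

    Reversing the order of the E_i sends m_k to m_(d-k), so invariance under
    this operation follows once S(k) agrees with the sum S'(d-k) built from the
    reversed eigenvalues. Both are terminating balanced sums, and a Saalschutz
    type summation evaluates them ([kernel_product]):
    S(k) = X_0 ... X_(k-1) p_(k+1) ... p_d, where X_j is the reversed factor
    p'_(d-j) times w_(j+1) / w_(d-j), for weights w equal to alpha when alpha
    does not vanish. The right-hand side is visibly symmetric
    ([kernel_reversal]). The summation itself is Newton interpolation: it
    amounts to a closed form for all divided differences of that right-hand
    side, which is checked by a two-term recurrence. The recurrence reduces to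
    an identity between eigenvalues, proved from their closed forms, which are
    combinations of 1, Q^i, Q^-i (type I), of 1, i, i^2 (type II), or arithmetic
    on each parity class (types III and IV). In type III+ the polynomial is
    computed outright, as a scalar times a power of a product of two linear
    factors which the reversal exchanges ([prod_factor_IIIplus]).

    Exchanging A and As fixes every p_i, and it fixes every zeta_i
    ([zeta_star]): for v on the line of Es_0, expand E_0 v by Newton
    interpolation in the vectors tau_k(A) v; of these only k = i contributes to
    E_0 taus_i(As) E_0 v, where taus_i is the analogue of tau_i for the ths, and
    its contribution is zeta_i. The remaining operation is the conjugate of the
    reversal by this exchange. That the extreme eigenspaces of all relatives
    are lines, and that E_0 v is nonzero, both come from irreducibility
    ([low1_high1_eq0]). *)

(** * Newton interpolation and a Saalschutz summation *)

Section NewtonTable.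

Variable R : comNzRingType.
Implicit Types (t s p X : nat -> R) (D B : nat -> nat -> R).

(** Newton's formula, for a table D in the role of the divided differences
    D a i = f[t_a, ..., t_(a+i)], whose recurrence is written without division.
    The induction moves the starting node a up to k. *)
Lemma newton_interpolation t D k :
  (forall a i, (a + i < k)%N ->
     D a.+1 i = D a i + (t (a + i).+1 - t a) * D a i.+1) ->
  forall m a, (a + m)%N = k ->
    \sum_(0 <= i < m.+1) D a i * \prod_(0 <= h < i) (t k - t (a + h)%N) = D k 0.
Proof.
move=> Dstep; elim=> [|m IHm] a am.
  by rewrite big_nat1 big_geq // mulr1 -am addn0.
rewrite -(IHm a.+1) ?addSnnS // [RHS](_ : _ =
    \sum_(0 <= i < m.+1) D a i * \prod_(0 <= h < i) (t k - t (a.+1 + h)%N) +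
    \sum_(0 <= i < m.+1) (t (a + i).+1 - t a) * D a i.+1 *
       \prod_(0 <= h < i) (t k - t (a.+1 + h)%N)); last first.
  rewrite -big_split /= [LHS]big_nat [RHS]big_nat.
  by apply: eq_bigr => i /andP[_ im]; rewrite Dstep ?mulrDl //; lia.
rewrite big_nat_recl // big_geq // mulr1.
under eq_bigr => i _.
  rewrite big_nat_recl // addn0; under eq_bigr => h _ do rewrite -addSnnS.
  rewrite (_ : D a i.+1 * _ = D a i.+1 * ((t k - t (a + i).+1) *
      \prod_(0 <= h < i) (t k - t (a.+1 + h)%N)) +
      (t (a + i).+1 - t a) * D a i.+1 *
      \prod_(0 <= h < i) (t k - t (a.+1 + h)%N)); last by ring.
  over.
rewrite big_split /= addrA; congr (_ + _).
rewrite big_nat_recr // [in RHS]big_nat_recl // [in RHS]big_geq // mulr1 /=.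
rewrite -addnS am subrr mul0r mulr0 addr0; congr (_ + _).
apply: eq_bigr => i _; rewrite big_nat_recr //= -addSn.
by rewrite mulrC [in RHS]mulrC [_ * (_ - _)]mulrC.
Qed.

(** The summands are the terms of Newton's formula for the function
    k |-> X_0 ... X_(k-1) p_(k+1) ... p_d: its divided difference at the nodes
    t_a, ..., t_(a+i) is s_1 ... s_i B(a,i) X_0 ... X_(a-1) p_(a+i+1) ... p_d, and
    the hypothesis on B is the recurrence that these must satisfy. *)
Lemma saalschutz_sum t s p X B d :
  (forall a, B a 0%N = 1) -> (forall i, (i <= d)%N -> B 0%N i = 1) ->
  (forall a i, (a + i < d)%N -> B a.+1 i * X a - B a i * p (a + i).+1 =
     B a i.+1 * s i.+1 * (t (a + i).+1 - t a)) ->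
  forall k, (k <= d)%N ->
  \sum_(0 <= i < d.+1) \prod_(1 <= j < i.+1) s j *
     \prod_(0 <= h < i) (t k - t h) * \prod_(i.+1 <= j < d.+1) p j =
  \prod_(0 <= j < k) X j * \prod_(k.+1 <= j < d.+1) p j.
Proof.
move=> B0r B0l Bstep k kd.
pose D a i := B a i * \prod_(1 <= j < i.+1) s j * \prod_(0 <= j < a) X j *
  \prod_((a + i).+1 <= j < d.+1) p j.
transitivity (D k 0%N); last first.
  by rewrite /D B0r addn0 big_geq // !mul1r.
rewrite -(@newton_interpolation t D k _ k 0%N) //; last first.
  move=> a i aik; rewrite /D addSn !addnS (@big_ltn _ _ _ (a + i).+1); last lia.
  rewrite (@big_nat_recr _ _ _ a 0) // (@big_nat_recr _ _ _ i.+1 1) //=.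
  set S := \prod_(1 <= j < i.+1) _; set Xs := \prod_(0 <= j < a) _.
  set ps := \prod_(_.+2 <= j < _) _; apply/eqP; rewrite -subr_eq0.
  have := Bstep a i (leq_trans aik kd) => e.
  rewrite (_ : _ - _ = S * Xs * ps * ((B a.+1 i * X a - B a i * p (a + i).+1) -
     B a i.+1 * s i.+1 * (t (a + i).+1 - t a))); last by ring.
  by rewrite e subrr mulr0.
(* the terms with i > k contain the factor t k - t k *)
rewrite (@big_cat_nat _ _ _ k.+1) //=.
rewrite [X in _ + X]big_nat_cond [X in _ + X]big1 ?addr0; last first.
  move=> i /andP[/andP[ki _] _].
  rewrite (@big_cat_nat _ _ _ k 0 i) ?(ltnW ki) //= (@big_ltn _ _ _ k) //.
  by rewrite subrr mul0r mulr0 mulr0 mul0r.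
apply: eq_big_nat => i /andP[_ ik]; rewrite /D B0l ?(leq_trans _ kd) //.
rewrite (big_geq (leqnn 0)) !add0n mul1r mulr1.
by rewrite -!mulrA; congr (_ * _); rewrite mulrC.
Qed.

End NewtonTable.

(** * Reversing the order of the eigenvalues *)

Section Reversal.

Variable F : fieldType.
Implicit Types (t ts alpha w : nat -> F) (d : nat).

(** These restate the ingredients of the Drinfel'd polynomial for arbitrary
    sequences, so that reversing the eigenvalues makes sense before any
    tridiagonal system is in sight. *)
Definition corner_seq t ts d : {poly F} :=
  (t 0%N * ts d + t d * ts 0%N)%:P - 'X.

Definition factor_seq alpha t ts d i : {poly F} :=
  alpha i *: corner_seq t ts d + ((t 0%N - t i) * (ts 0%N - ts i))%:P.

Definition reversal d t i := t (d - i)%N.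

(** The coefficient of the spectral mass m_k in the Drinfel'd polynomial. *)
Definition kernel alpha t ts d k : {poly F} :=
  \sum_(0 <= i < d.+1)
    (\prod_(1 <= j < i.+1) (ts 0%N - ts j) * \prod_(0 <= h < i) (t k - t h)) *:
      \prod_(i.+1 <= j < d.+1) factor_seq alpha t ts d j.

(** What the summation needs from the eigenvalues. B plays the role of a squared
    q-binomial coefficient; it is part of the data because it is a quotient of
    products of the weights in types I and II, but not in types III- and IV. *)
Definition saalschutz_data alpha t ts d w :=
  (forall i, (0 < i <= d)%N -> w i != 0) /\
  exists B : nat -> nat -> F,
    [/\ forall a, B a 0%N = 1, forall i, (i <= d)%N -> B 0%N i = 1
      & forall a i, (a + i < d)%N ->
        B a.+1 i *: ((w a.+1 / w (d - a)%N) *: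
                       factor_seq alpha (reversal d t) ts d (d - a)%N) -
        B a i *: factor_seq alpha t ts d (a + i).+1 =
        (B a i.+1 * (ts 0%N - ts i.+1) * (t (a + i).+1 - t a))%:P].

Lemma kernel_product alpha t ts d w k :
  saalschutz_data alpha t ts d w -> (k <= d)%N ->
  kernel alpha t ts d k =
    \prod_(0 <= j < k) ((w j.+1 / w (d - j)%N) *:
                          factor_seq alpha (reversal d t) ts d (d - j)%N) *
    \prod_(k.+1 <= j < d.+1) factor_seq alpha t ts d j.
Proof.
case=> _ [B [Ba0 B0i Bstep]] kd.
rewrite -(@saalschutz_sum _ (fun i => (t i)%:P) (fun j => (ts 0%N - ts j)%:P)
   (factor_seq alpha t ts d) _ (fun a i => (B a i)%:P)) //.
- rewrite /kernel; apply: eq_bigr => i _.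
  rewrite -mul_polyC polyCM !rmorph_prod /=; congr (_ * _ * _).
  by apply: eq_bigr => h _; rewrite polyCB.
- by move=> a; rewrite Ba0.
- by move=> i id; rewrite B0i.
by move=> a i ai; rewrite -!polyCB -!polyCM !mul_polyC Bstep.
Qed.

Lemma prod_rev_tail (R : comNzRingType) (f : nat -> R) d k : (k <= d)%N ->
  \prod_(0 <= j < k) f (d - j)%N = \prod_((d - k).+1 <= j < d.+1) f j.
Proof.
elim: k => [|k IHk] kd; first by rewrite subn0 !big_geq.
rewrite big_nat_recr //= IHk 1?ltnW // [in RHS]big_ltn; last lia.
by rewrite mulrC (_ : (d - k.+1).+1 = (d - k)%N) //; lia.
Qed.

(** With w! the product of the first weights, the left-hand side is
    w_k! w_(d-k)! / w_d!, the inverse of a binomial coefficient. *)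
Lemma binomial_weight_sym d w k :
    (forall i, (0 < i <= d)%N -> w i != 0) -> (k <= d)%N ->
  \prod_(0 <= j < k) (w j.+1 / w (d - j)%N) =
  \prod_(0 <= j < d - k) (w j.+1 / w (d - j)%N).
Proof.
move=> w0; pose W n := \prod_(1 <= j < n.+1) w j.
have W0 n : (n <= d)%N -> W n != 0.
  rewrite /W => nd; rewrite big_nat_cond prodf_seq_neq0.
  by apply/allP => i _; apply/implyP => /andP[/andP[? ?] _]; apply: w0; lia.
have C n : (n <= d)%N ->
    \prod_(0 <= j < n) (w j.+1 / w (d - j)%N) = W n * W (d - n)%N / W d.
  move=> nd; rewrite prodf_div prod_rev_tail // [X in X / _](_ : _ = W n); last first.
    by rewrite /W big_add1.
  have := W0 d (leqnn d).
  rewrite /W (@big_cat_nat _ _ _ (d - n).+1 1 d.+1) //=; last lia.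
  rewrite -/(W (d - n)%N) mulf_eq0 negb_or => /andP[? ?].
  by field; apply/andP.
by move=> kd; rewrite !C ?leq_subr // subKn // [W k * _]mulrC.
Qed.

Lemma factor_reversalK alpha t ts d i : (i <= d)%N ->
  factor_seq alpha (reversal d (reversal d t)) ts d i = factor_seq alpha t ts d i.
Proof. by move=> i_d; rewrite /factor_seq /corner_seq /reversal !subKn. Qed.

(** In the product formula for either side, each factor p_j or p'_j occurs once,
    on the same ranges of indices; only the scalars have to be compared, and
    these are equal by the symmetry of the binomial coefficients. *)
Lemma kernel_reversal alpha t ts d w k :
  saalschutz_data alpha t ts d w ->
  saalschutz_data alpha (reversal d t) ts d w -> (k <= d)%N ->
  kernel alpha t ts d k = kernel alpha (reversal d t) ts d (d - k)%N.
Proof.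
move=> dt drt kd; rewrite (kernel_product dt kd).
rewrite (kernel_product drt (leq_subr _ _)) !scaler_prod.
rewrite (binomial_weight_sym dt.1 kd) -!scalerAl; congr (_ *: _).
rewrite !prod_rev_tail ?leq_subr // subKn // mulrC; congr (_ * _).
apply: eq_big_nat => i /andP[_ i_d]; symmetry.
exact: factor_reversalK.
Qed.

(** The recurrence that the base beta expresses, cleared of denominators. *)
Definition recurrent beta d t :=
  forall i, (i + 3 <= d)%N -> t i - t i.+3 = (beta + 1) * (t i.+1 - t i.+2).

Lemma recurrent_reversal beta d t :
  recurrent beta d t -> recurrent beta d (reversal d t).
Proof.
move=> rt i id; have e : _ = _ := rt (d - i.+3)%N ltac:(lia); rewrite /reversal.
have [-> -> ->] : [/\ (d - i = (d - i.+3).+3)%N, (d - i.+1 = (d - i.+3).+2)%N &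
   (d - i.+2 = (d - i.+3).+1)%N] by split; lia.
by rewrite -opprB e -mulrN opprB.
Qed.

Lemma recurrent_eq beta d t u :
  recurrent beta d t -> recurrent beta d u ->
  t 0%N = u 0%N -> t 1%N = u 1%N -> t 2%N = u 2%N ->
  forall n, (n <= d)%N -> t n = u n.
Proof.
move=> rt ru e0 e1 e2; elim/ltn_ind=> -[|[|[|n]]] // IH nd.
have nd3 : (n + 3 <= d)%N by rewrite addn3.
have three v : recurrent beta d v -> v n.+3 = v n - (beta + 1) * (v n.+1 - v n.+2).
  by move=> rv; rewrite -(rv n nd3) subKr.
by rewrite !three // !IH //; lia.
Qed.

End Reversal.

(** * Types I and II: nonvanishing weights *)

Section RatioWeights.

Variable F : fieldType.
Implicit Types (t ts alpha : nat -> F) (d : nat).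

(** Divided by alpha_n, the factor p_n is the corner plus the first summand, and
    likewise p'_(d-a) divided by alpha_(d-a) is the reversed corner plus the
    second summand at n = d. The two corners differ by
    (th_0 - th_d)(ths_0 - ths_d), the first summand at n = d. So the recurrence
    for B says exactly that this quantity does not depend on n. *)
Definition residue alpha t ts a n : F :=
  (t 0%N - t n) * (ts 0%N - ts n) / alpha n +
  (t n - t a) * (ts 0%N - ts (n - a)%N) / alpha (n - a)%N.

Lemma saalschutz_data_residue alpha t ts d :
  (forall i, (0 < i <= d)%N -> alpha i != 0) -> ((0 < d)%N -> alpha d = 1) ->
  (forall a n, (a < n <= d)%N -> residue alpha t ts a n = residue alpha t ts a d) ->
  saalschutz_data alpha t ts d alpha.
Proof.
move=> al0 al1 residueE; split=> //.
(* the binomial coefficient (a + i choose i) for the weights alpha *)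
pose B a i := \prod_(1 <= h < i.+1) (alpha (a + h)%N / alpha h).
exists B; split.
- by move=> a; rewrite /B big_geq.
- move=> i i_d; rewrite /B big_nat_cond big1 // => h /andP[/andP[h0 hi] _].
  by rewrite add0n divff // al0 //; lia.
move=> a i ai.
have a1 : alpha a.+1 != 0 by apply: al0; lia.
have ai1 : alpha (a + i).+1 != 0 by apply: al0; lia.
have i1 : alpha i.+1 != 0 by apply: al0; lia.
have da : alpha (d - a)%N != 0 by apply: al0; lia.
have Br : B a i.+1 = B a i * alpha (a + i).+1 / alpha i.+1.
  by rewrite /B big_nat_recr //= addnS mulrA.
have Bl : B a.+1 i = B a i * alpha (a + i).+1 / alpha a.+1.
  have shift n : (n <= i)%N -> B a.+1 n * alpha a.+1 = B a n * alpha (a + n).+1.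
    elim: n => [|n IHn] ni; first by rewrite /B !big_geq // addn0.
    have n1 : alpha n.+1 != 0 by apply: al0; lia.
    have BS b : B b n.+1 = B b n * (alpha (b + n).+1 / alpha n.+1).
      by rewrite /B big_nat_recr //= addnS.
    rewrite !BS mulrAC IHn ?(ltnW ni) // addSn addnS.
    by field.
  by rewrite -shift // mulfK.
have /(canRL (subrK _)) Z : residue alpha t ts a (a + i).+1 - residue alpha t ts a d = 0.
  by rewrite residueE ?subrr //; lia.
have ei : ((a + i).+1 - a = i.+1)%N by lia.
pose u := (t 0%N - t (a + i).+1) * (ts 0%N - ts (a + i).+1) / alpha (a + i).+1.
pose v := (t d - t a) * (ts 0%N - ts (d - a)%N) / alpha (d - a)%N.
pose b := B a i * alpha (a + i).+1.
have -> : B a i *: factor_seq alpha t ts d (a + i).+1 = b *: (corner_seq t ts d + u%:P).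
  rewrite /factor_seq scalerDr [in RHS]scalerDr scalerA; congr (_ + _).
  by rewrite -!mul_polyC -!polyCM; congr polyC; rewrite /b /u; field.
have -> : B a.+1 i *: ((alpha a.+1 / alpha (d - a)%N) *:
    factor_seq alpha (reversal d t) ts d (d - a)%N) =
    b *: (corner_seq (reversal d t) ts d + v%:P).
  rewrite /factor_seq !scalerDr !scalerA; congr (_ + _).
    rewrite (_ : _ * _ * _ = b) //.
    by rewrite Bl /b; field; apply/andP.
  rewrite -!mul_polyC -!polyCM; congr polyC.
  by rewrite Bl /b /v /reversal subn0 subKn; [field; apply/andP | lia].
rewrite -scalerBr /corner_seq /reversal subn0 subnn.
have cancelX c1 c2 : c1%:P - 'X + v%:P - (c2%:P - 'X + u%:P) = (c1 + v - (c2 + u))%:P.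
  by rewrite polyCB !polyCD; ring.
rewrite cancelX -mul_polyC -polyCM; congr polyC.
have ald : alpha d = 1 by apply: al1; lia.
move: Z; rewrite /residue ei ald divr1 -/u -/v add0r => Z.
transitivity (b * ((t (a + i).+1 - t a) * (ts 0%N - ts i.+1) / alpha i.+1)).
  by congr (_ * _); apply: (addrI u); rewrite Z; ring.
by rewrite Br /b; field.
Qed.

End RatioWeights.

Section ResidueTypes.

Variable K : fieldType.
Implicit Types (t ts alpha : nat -> K) (d : nat).

Definition q_sequence (Q : K) d t (x y : K) :=
  forall n, (n <= d)%N -> t n = t 0%N + x * (Q ^+ n - 1) + y * (Q ^- n - 1).

(** The recurrence has order three, so it suffices to match three values; the
    system for x and y is invertible because Q is not 1 or -1. *)
Lemma recurrent_q_sequence (Q : K) d t :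
  Q != 0 -> Q != 1 -> Q != -1 -> recurrent (Q + Q^-1) d t ->
  exists x y, q_sequence Q d t x y.
Proof.
move=> Q0 Q1 QN1 rt.
have q1 : Q - 1 != 0 by rewrite subr_eq0.
have q2 : Q + 1 != 0 by rewrite addr_eq0.
pose a := (t 1%N - t 0%N) / (Q - 1).
pose b := (t 2%N - t 0%N) / (Q ^+ 2 - 1).
have q12 : Q ^+ 2 - 1 != 0.
  by rewrite (_ : _ - _ = (Q - 1) * (Q + 1)) ?mulf_neq0 //; ring.
pose y := (b - a) * Q ^+ 2 / (Q - 1); pose x := a + y / Q.
have t1 : t 1%N = t 0%N + x * (Q - 1) + y * (Q^-1 - 1).
  by rewrite /x /a; field; apply/andP.
have t2 : t 2%N = t 0%N + x * (Q ^+ 2 - 1) + y * (Q ^- 2 - 1).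
  rewrite (_ : t 0%N + _ + _ =
    t 0%N + (Q ^+ 2 - 1) * (a + y * (Q - 1) / Q ^+ 2)); last first.
    by rewrite /x; field.
  rewrite /y (_ : a + _ = b); last by field; apply/andP.
  by rewrite /b mulrC divfK // addrC subrK.
exists x, y => n nd.
pose u n := t 0%N + x * (Q ^+ n - 1) + y * (Q ^- n - 1).
apply: (recurrent_eq (u := u) rt _ _ _ _ nd); rewrite /u //.
- move=> i _; rewrite !exprS.
  have Qi : Q ^+ i != 0 by rewrite expf_neq0.
  by field; apply/andP.
- by rewrite !expr0 invr1 subrr !mulr0 !addr0.
Qed.

(** In closed form the terms in Q^n and Q^-n of the two summands of the residue
    cancel, leaving an expression in a alone. *)
Lemma residue_q_sequence Q d t ts alpha c x y xs ys :
  Q != 0 -> c != 0 -> (forall n, (0 < n <= d)%N -> Q ^+ n != 1) ->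
  q_sequence Q d t x y -> q_sequence Q d ts xs ys ->
  (forall n, (0 < n <= d)%N -> alpha n = (Q ^+ n - 1) ^+ 2 / Q ^+ n / c) ->
  forall a n, (a < n <= d)%N ->
  residue alpha t ts a n =
    c * (x * ys * (Q ^+ a - 1) + y * xs * (Q ^- a - 1)).
Proof.
move=> Q0 c0 Qn tE tsE alE a n /andP[an nd].
have na : (0 < n - a <= d)%N by lia.
have n0 : (0 < n <= d)%N by lia.
have [an' nad] : (a <= d)%N /\ (n - a <= d)%N by lia.
rewrite /residue !alE // (tE n nd) (tE a an') (tsE n nd) (tsE _ nad).
have := Qn _ na; have := Qn _ n0.
have -> : Q ^+ n = Q ^+ a * Q ^+ (n - a) by rewrite -exprD subnKC // ltnW.
move: (expf_neq0 a Q0) (expf_neq0 (n - a) Q0).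
move: (Q ^+ a) (Q ^+ (n - a)) => J M J0 M0.
rewrite -subr_eq0 => JM1; rewrite -subr_eq0 => M1.
by field; rewrite J0 M0 c0 JM1 M1.
Qed.

Definition quadratic_sequence d t (x y : K) :=
  forall n, (n <= d)%N -> t n = t 0%N + x * n%:R + y * n%:R ^+ 2.

Lemma recurrent_quadratic d t : (2 : K) != 0 -> recurrent 2 d t ->
  exists x y, quadratic_sequence d t x y.
Proof.
move=> two0 rt.
pose y := (t 2%N - t 0%N - 2 * (t 1%N - t 0%N)) / 2.
pose x := t 1%N - t 0%N - y.
pose u n := t 0%N + x * n%:R + y * n%:R ^+ 2.
exists x, y => n nd; apply: (recurrent_eq (u := u) rt _ _ _ _ nd); rewrite /u.
- by move=> i _; ring.
- by ring.
- by rewrite /x; ring.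
- by rewrite /x /y; field.
Qed.

(** In closed form the dependence on n cancels: the terms in n and n^2 of the
    first summand of the residue are undone by the second. *)
Lemma residue_quadratic d t ts alpha c x y xs ys :
  c != 0 -> (forall n, (0 < n <= d)%N -> n%:R != 0 :> K) ->
  quadratic_sequence d t x y -> quadratic_sequence d ts xs ys ->
  (forall n, (0 < n <= d)%N -> alpha n = n%:R ^+ 2 / c) ->
  forall a n, (a < n <= d)%N ->
  residue alpha t ts a n = c * ((x * ys - y * xs) * a%:R + y * ys * a%:R ^+ 2).
Proof.
move=> c0 nz tE tsE alE a n /andP[an nd].
have na : (0 < n - a <= d)%N by lia.
have n0 : (0 < n <= d)%N by lia.
have [an' nad] : (a <= d)%N /\ (n - a <= d)%N by lia.
rewrite /residue !alE // (tE n nd) (tE a an') (tsE n nd) (tsE _ nad).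
have := nz _ na; have := nz _ n0.
have -> : n%:R = a%:R + (n - a)%:R :> K by rewrite -natrD subnKC // ltnW.
move: (a%:R : K) ((n - a)%:R : K) => J M JM M0.
by field; rewrite ?c0 ?JM ?M0.
Qed.
End ResidueTypes.

(** * Base -2: types III and IV *)

Section Alternating.

Variable F : fieldType.
Implicit Types (t ts alpha : nat -> F) (d : nat).

(** For beta = -2 the even-indexed and the odd-indexed terms are arithmetic
    progressions with opposite differences. Unlike the usual closed form this
    also covers characteristic 2. *)
Definition alternating_sequence d t (h : F) :=
  forall m, ((m.*2 <= d)%N -> t m.*2 = t 0%N + m%:R * h) /\
            ((m.*2 < d)%N -> t m.*2.+1 = t 1%N - m%:R * h).

Lemma recurrent_alternating d t :
  recurrent (- 2) d t -> exists h, alternating_sequence d t h.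
Proof.
move=> rt; pose h := t 2%N - t 0%N; exists h.
pose u n := if odd n then t 1%N - n./2%:R * h else t 0%N + n./2%:R * h.
have tu n : (n <= d)%N -> t n = u n.
  apply: (recurrent_eq rt); rewrite /u /=.
  - move=> i _; rewrite /= !negbK; case: (odd i); rewrite /= -?natr1 //.
      rewrite uphalf_half; case: (odd i) => //=; ring.
    ring.
  - by rewrite mul0r addr0.
  - by rewrite mul0r subr0.
  - by rewrite mul1r addrC subrK.
move=> m; split=> md; rewrite tu // /u /= odd_double ?doubleK //=.
by rewrite uphalf_double.
Qed.

Definition parity n : F := if odd n then 1 else 0.
(** Up to the common factor h hs, the value of p_i at an even i; it replaces
    alpha_i, which vanishes there, in the comparison of p_i with its reversed
    counterpart. *)
Definition parity_weight n : F := if odd n then 1 else n./2%:R ^+ 2.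

(** The coefficients B are the squares of Gaussian binomial coefficients at -1:
    zero when a and i are both odd, and otherwise ordinary binomial coefficients
    of the halves. The recurrence is checked for each pair of parities; in each
    case it is one of the absorption identities for binomial coefficients, or,
    for a and i even, an identity between the eigenvalues. *)
Lemma saalschutz_data_alternating t ts d h hs alpha :
  odd d -> (forall m, (0 < m)%N -> (m.*2 <= d)%N -> m%:R != 0 :> F) ->
  alternating_sequence d t h -> alternating_sequence d ts hs ->
  (forall n, (0 < n <= d)%N -> alpha n = parity n) ->
  saalschutz_data alpha t ts d parity_weight.
Proof.
move=> d_odd nz tE sE alE.
pose D := d./2; have dE : d = D.*2.+1 by rewrite -[d]odd_double_half d_odd.
split.
  move=> i /andP[i0 id]; rewrite /parity_weight; case: ifP => io; first exact: oner_neq0.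
  by rewrite expf_neq0 // nz //; lia.
pose B a i : F := if odd a && odd i then 0 else 'C((a + i)./2, i./2)%:R ^+ 2.
exists B; split.
- by move=> a; rewrite /B andbF bin0 expr1n.
- by move=> i _; rewrite /B binn expr1n.
have td : t d = t 1%N - D%:R * h by rewrite {1}dE; apply: (tE D).2; lia.
have sd : ts d = ts 1%N - D%:R * hs by rewrite {1}dE; apply: (sE D).2; lia.
have binr x y : (x + y).+1%:R * 'C(x + y, y)%:R = x.+1%:R * 'C((x + y).+1, y)%:R :> F.
  rewrite -!natrM -[(x + y)%N]/((x + y).+1.-1) mul_bin_down /=.
  by rewrite subSn ?leq_addl // addnK.
have binl x y : (x + y).+1%:R * 'C(x + y, y)%:R = y.+1%:R * 'C((x + y).+1, y.+1)%:R :> F.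
  by rewrite -!natrM -[(x + y)%N]/((x + y).+1.-1) mul_bin_diag.
have even_factor m : (0 < m)%N -> (m.*2 <= d)%N ->
    factor_seq alpha t ts d m.*2 = (m%:R ^+ 2 * (h * hs))%:P.
  move=> m0 md; rewrite /factor_seq alE ?md ?double_gt0 ?m0 // /parity.
  rewrite odd_double scale0r add0r.
  by rewrite (tE m).1 // (sE m).1 //; congr polyC; ring.
have odd_X x : (x.*2.+1 < d)%N ->
    (parity_weight x.*2.+2 / parity_weight (d - x.*2.+1)%N) *:
      factor_seq alpha (reversal d t) ts d (d - x.*2.+1)%N =
    (x.+1%:R ^+ 2 * (h * hs))%:P.
  move=> xd; have -> : (d - x.*2.+1 = (D - x).*2)%N by rewrite doubleB; lia.
  have Dx : (D - x)%:R != 0 :> F by apply: nz; lia.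
  rewrite /factor_seq alE; last by apply/andP; split; lia.
  rewrite /parity /parity_weight /= !odd_double /= !doubleK scale0r add0r.
  rewrite (sE (D - x)%N).1 /reversal ?subn0; last lia.
  have -> : (d - (D - x).*2 = x.*2.+1)%N by rewrite doubleB; lia.
  rewrite (tE x).2 1?ltnW // td -mul_polyC -polyCM; congr polyC.
  rewrite (_ : D%:R = (D - x)%:R + x%:R); last by rewrite -natrD subnK //; lia.
  by field.
move=> a i aid.
have Bee x y : B x.*2 y.*2 = 'C(x + y, y)%:R ^+ 2.
  by rewrite /B !odd_double -doubleD !doubleK.
have Boe x y : B x.*2.+1 y.*2 = 'C(x + y, y)%:R ^+ 2.
  by rewrite /B !odd_double andbF addSn -doubleD /= uphalf_double doubleK.
have Beo x y : B x.*2 y.*2.+1 = 'C(x + y, y)%:R ^+ 2.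
  by rewrite /B !odd_double addnS -doubleD /= !uphalf_double.
have Boo x y : B x.*2.+1 y.*2.+1 = 0 by rewrite /B /= !odd_double.
rewrite -[a]odd_double_half -[i]odd_double_half in aid *.
move: (odd a) (odd i) a./2 i./2 aid => [] [] x y /=; rewrite !(add0n, add1n) => aid.
- rewrite odd_X; last lia.
  rewrite -!doubleS Beo Boo Boe scale0r subr0 (sE y.+1).1; last lia.
  rewrite (_ : (x.*2.+1 + y.*2.+1).+1 = (x + y).+1.*2.+1); last first.
    by rewrite doubleS doubleD; lia.
  rewrite (tE (x + y).+1).2 ?(tE x).2; try by rewrite ?doubleS ?doubleD; lia.
  rewrite -mul_polyC -polyCM addSn addnS; congr polyC.
  have := binl x y; rewrite binr => e.
  transitivity ((x.+1%:R * 'C((x + y).+1, y)%:R) ^+ 2 * (h * hs)).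
    by rewrite exprMn; ring.
  by rewrite e -addnS natrD; ring.
- rewrite odd_X; last lia.
  rewrite -!doubleS Bee Boo Boe (_ : (x.*2.+1 + y.*2).+1 = (x + y).+1.*2); last first.
    by rewrite doubleS doubleD; lia.
  rewrite even_factor //; last by rewrite doubleS doubleD; lia.
  rewrite !mul0r -!mul_polyC -!polyCM -polyCB addSn; congr polyC.
  transitivity (((x.+1%:R * 'C((x + y).+1, y)%:R) ^+ 2 -
     ((x + y).+1%:R * 'C(x + y, y)%:R) ^+ 2) * (h * hs)); first by rewrite !exprMn; ring.
  by rewrite binr subrr mul0r.
- rewrite -!doubleS Bee Boo Beo scale0r sub0r.
  rewrite (_ : (x.*2 + y.*2.+1).+1 = (x + y).+1.*2); last first.
    by rewrite doubleS doubleD; lia.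
  rewrite even_factor //; last by rewrite doubleS doubleD; lia.
  rewrite (sE y.+1).1 ?(tE (x + y).+1).1 ?(tE x).1; try by rewrite ?doubleS ?doubleD; lia.
  rewrite -mul_polyC -polyCM -polyCN addnS; congr polyC.
  transitivity (- ((x + y).+1%:R * 'C(x + y, y)%:R) ^+ 2 * (h * hs)).
    by rewrite exprMn; ring.
  by rewrite binl -addnS natrD; ring.
rewrite Boe Bee Beo -doubleD.
have evenx : parity_weight x.*2.+1 / parity_weight (d - x.*2)%N = 1.
  rewrite /parity_weight /= odd_double /= oddB ?odd_double ?d_odd /= ?divr1 //; lia.
rewrite evenx scale1r -scalerBr -[RHS]/((_ * _ * _)%:P) -mulrA polyCM mul_polyC.
congr (_ *: _).
have dx : (d - x.*2 = (D - x).*2.+1)%N by rewrite doubleB; lia.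
rewrite /factor_seq /corner_seq !alE; try by rewrite ?doubleD; lia.
rewrite /parity dx /= !odd_double !scale1r /reversal subn0 subnn -dx subKn; last by lia.
rewrite dx (sE (D - x)%N).2 ?(sE (x + y)%N).2 ?(tE (x + y)%N).2 ?(tE x).1 ?(sE y).2;
  try by rewrite ?doubleD ?doubleB; lia.
rewrite td sd (_ : D%:R = (D - x)%:R + x%:R); last by rewrite -natrD subnK //; lia.
by rewrite natrD !(polyCB, polyCD, polyCM); ring.
Qed.

End Alternating.

Section IIIplus.

Variable F : fieldType.
Implicit Types (t ts : nat -> F) (d : nat).

Definition factor_IIIplus t ts d i : {poly F} :=
  if odd i then corner_seq t ts d
  else (i%:R ^+ 2 / d%:R ^+ 2) *: corner_seq t ts d +
       ((t 0%N - t i) * (ts 0%N - ts i))%:P.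

(** The gap at an even index 2m is m^2 h hs, so p_(2m) is a multiple of p_d,
    which is the corner of the reversed sequence; and p_i is the corner for i
    odd. *)
Lemma prod_factor_IIIplus t ts d D h hs :
  d = D.*2 -> (2 : F) != 0 -> ((0 < D)%N -> D%:R != 0 :> F) ->
  alternating_sequence d t h -> alternating_sequence d ts hs ->
  \prod_(1 <= i < d.+1) factor_IIIplus t ts d i =
  (\prod_(1 <= m < D.+1) (m%:R ^+ 2 / D%:R ^+ 2)) *:
    (corner_seq t ts d * corner_seq (reversal d t) ts d) ^+ D.
Proof.
move=> -> two0 D0 tE sE.
have even_factor m : (0 < m <= D)%N -> factor_IIIplus t ts D.*2 m.*2 =
    (m%:R ^+ 2 / D%:R ^+ 2) *: corner_seq (reversal D.*2 t) ts D.*2.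
  move=> /andP[m0 mD]; rewrite /factor_IIIplus odd_double.
  have D00 : D%:R != 0 :> F by apply: D0; lia.
  rewrite /corner_seq /reversal subn0 subnn.
  rewrite (tE m).1 ?(sE m).1 ?(tE D).1 ?(sE D).1 ?leq_double //.
  rewrite -!muln2 !natrM; set c := _ / _.
  rewrite (_ : c = m%:R ^+ 2 / D%:R ^+ 2); last first.
    by rewrite /c; field; apply/andP.
  rewrite !scalerBr -!mul_polyC -!polyCM addrAC -polyCD; congr (_%:P - _).
  by field.
suff prodE n : (n <= D)%N -> \prod_(1 <= i < n.*2.+1) factor_IIIplus t ts D.*2 i =
    (\prod_(1 <= m < n.+1) (m%:R ^+ 2 / D%:R ^+ 2)) *:
    (corner_seq t ts D.*2 * corner_seq (reversal D.*2 t) ts D.*2) ^+ n by exact: prodE.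
elim: n => [|n IHn] nD; first by rewrite !big_geq // expr0 scale1r.
rewrite doubleS (@big_nat_recr _ _ _ n.*2.+2 1) // (@big_nat_recr _ _ _ n.*2.+1 1) //=.
rewrite (@big_nat_recr _ _ _ n.+1 1) //= IHn 1?ltnW // -doubleS even_factor ?nD //.
rewrite /factor_IIIplus /= odd_double /=.
set P := \prod_(1 <= m < _) _; move: (_ / _) => c.
rewrite -!mul_polyC polyCM; move: (P%:P) (c%:P) => p q.
rewrite [_ ^+ n.+1]exprSr; ring.
Qed.

End IIIplus.

(** * Eigenspace projections of a tridiagonal pair *)

Section Spectral.

Variables (F : fieldType) (V : vectType F).
Implicit Types (A As : 'End(V)) (U : {vspace V}).

Definition shifts A (c : nat -> F) (s : seq nat) : 'End(V) :=
  comp_list [seq A - c j *: \1%VF | j <- s].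

Lemma shifts_cons A c j s v :
  shifts A c (j :: s) v = A (shifts A c s v) - c j *: shifts A c s v.
Proof. by rewrite /shifts /= lfunE /= add_lfunE opp_lfunE scale_lfunE id_lfunE. Qed.

Lemma comp_list_cat (r s : seq 'End(V)) v :
  comp_list (r ++ s) v = comp_list r (comp_list s v).
Proof.
elim: r => [|f r IHr] /=; first by rewrite id_lfunE.
by rewrite !comp_lfunE IHr.
Qed.

Lemma shifts_eigen A c s a v :
  A v = a *: v -> shifts A c s v = (\prod_(j <- s) (a - c j)) *: v.
Proof.
move=> Av; elim: s => [|j s IHs]; first by rewrite big_nil scale1r /shifts /= id_lfunE.
rewrite shifts_cons IHs linearZ /= Av big_cons !scalerA -scalerBl mulrBl;
  congr (_ *: _); ring.
Qed.

(** The relations between A, As and the eigenspace projections of A on which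
    everything below rests. Apart from irreducibility, a tridiagonal system
    amounts to two sets of such relations, one with the roles of A and As
    exchanged. *)
Record spectral d A As (E : 'I_d.+1 -> 'End(V)) (th : nat -> F) : Prop := Spectral {
  spectral_sum : forall v, \sum_i E i v = v;
  spectral_proj : forall i j v, E i (E j v) = if i == j then E j v else 0;
  spectral_eigen : forall (i : 'I_d.+1) v, A (E i v) = th i *: E i v;
  spectral_inj : forall i j, (i <= d)%N -> (j <= d)%N -> th i = th j -> i = j;
  spectral_neq0 : forall i, limg (E i) != 0%VS;
  spectral_tridiag : forall (i j : 'I_d.+1) v,
    ((i.+1 < j) || (j.+1 < i))%N -> E j (As (E i v)) = 0
}.

(** The product of the A - a_j over all j other than i kills every summand but
    the i-th, and is a nonzero scalar on that one. *)
Lemma eigenspaces_direct A n (a : 'I_n -> F) (u : 'I_n -> V) :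
  injective a -> (forall i, A (u i) = a i *: u i) ->
  \sum_i u i = 0 -> forall i, u i = 0.
Proof.
move=> a_inj uE u0 i.
pose c (j : nat) := oapp a 0 (insub j).
have ca (j : 'I_n) : c j = a j by rewrite /c valK.
pose s := [seq nat_of_ord j | j <- enum 'I_n & j != i].
have := congr1 (shifts A c s) u0.
rewrite linear0 linear_sum (bigD1 i) //= big1 => [|j ji].
  rewrite addr0 (shifts_eigen _ _ (uE i)) => /eqP; rewrite scaler_eq0 => /orP[|/eqP//].
  rewrite big_map prodf_seq_eq0 => /hasP[j]; rewrite mem_filter => /andP[ji _].
  by rewrite ca subr_eq0 => /andP[_ /eqP/a_inj ij]; rewrite ij eqxx in ji.
rewrite (shifts_eigen _ _ (uE j)) (_ : \prod_(_ <- _) _ = 0) ?scale0r //.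
apply/eqP; rewrite prodf_seq_eq0; apply/hasP; exists (nat_of_ord j).
  by apply/mapP; exists j => //; rewrite mem_filter ji mem_enum.
by rewrite ca subrr eqxx.
Qed.

Lemma mem_leigenspace A a v : (v \in passmx.leigenspace A a) = (A v == a *: v).
Proof. by rewrite memv_ker add_lfunE opp_lfunE scale_lfunE id_lfunE subr_eq0. Qed.

End Spectral.

Section SpectralOfOrdering.

Variables (F : fieldType) (V : vectType F).
Implicit Types (A As : 'End(V)).

Lemma daddv_pi_kernel (U W : {vspace V}) w :
  (U :&: W = 0)%VS -> w \in W -> daddv_pi U W w = 0.
Proof.
move=> UW wW; have WU : (W :&: U = 0)%VS by rewrite capvC.
have := daddv_pi_add UW (subvP (addvSr U W) w wW).
by rewrite (daddv_pi_id WU wW) => /(canRL (addrK w)); rewrite subrr.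
Qed.

Lemma diagonalizable_span A d (W : 'I_d.+1 -> {vspace V}) v :
  diagonalizable_lfun A -> eigenspace_ordering A W -> v \in (\sum_i W i)%VS.
Proof.
move=> [X Xbas XA] [_ _ Wall]; apply: subvP (memvf v).
rewrite -(span_basis Xbas); apply/span_subvP => x xX.
have [a xa] := XA x xX.
have x0 : x != 0.
  by have /andP[_ /free_not0] := Xbas; apply.
have xE : x \in passmx.leigenspace A a by rewrite mem_leigenspace xa.
have [i Wi] : exists i, W i = passmx.leigenspace A a.
  apply: Wall; apply: contraNneq x0 => l0.
  by rewrite -memv0 -l0.
by rewrite -Wi in xE; apply: (subvP (sumv_sup i _ (subvv _))).
Qed.

Lemma spectral_of_ordering d (A As : 'End(V)) (E : 'I_d.+1 -> 'End(V)) W th :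
  diagonalizable_lfun A -> standard_ordering A As W -> projections_onto W E ->
  (forall i, (i <= d)%N -> th i = eigval_on A (limg (E (inord i)))) ->
  spectral A As E th.
Proof.
move=> Adiag [Word Wtri] EW thE.
have [W_inj Wval Wall] := Word.
have [a aP] : exists a : 'I_d.+1 -> F, forall i,
    passmx.leigenvalue A (a i) /\ W i = passmx.leigenspace A (a i).
  have aex i : exists b : F,
      passmx.leigenvalue A b && (W i == passmx.leigenspace A b).
    by have [b b1 b2] := Wval i; exists b; rewrite b1 b2 eqxx.
  by exists (fun i => xchoose (aex i)) => i; have /andP[? /eqP ?] := xchooseP (aex i).
have a_inj : injective a.
  by move=> i j aij; apply: W_inj; rewrite (aP i).2 (aP j).2 aij.
have memW i v : (v \in W i) = (A v == a i *: v) by rewrite (aP i).2 mem_leigenspace.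
have direct (u : 'I_d.+1 -> V) :
    (forall i, u i \in W i) -> \sum_i u i = 0 -> forall i, u i = 0.
  move=> uW; apply: (@eigenspaces_direct _ _ A _ a u a_inj) => i.
  by apply/eqP; have := uW i; rewrite memW.
have cap0 i : (W i :&: \sum_(j < d.+1 | j != i) W j = 0)%VS.
  apply/eqP; rewrite -subv0; apply/subvP => x; rewrite memv_cap => /andP[xi].
  case/memv_sumP => u uW xu; rewrite memv0.
  pose u' j := if j == i then - x else u j.
  have u'W j : u' j \in W j.
    by rewrite /u'; case: eqP => [->|/eqP ji]; [rewrite memvN | apply: uW].
  have : \sum_j u' j = 0.
    rewrite (bigD1 i) //= {1}/u' eqxx xu addrC; apply/eqP; rewrite subr_eq0; apply/eqP.
    by apply: eq_bigr => j /negPf ji; rewrite /u' ji.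
  by move/(direct _ u'W)/(_ i); rewrite /u' eqxx => /eqP; rewrite oppr_eq0.
have Eid i v : v \in W i -> E i v = v by move=> vi; rewrite EW daddv_pi_id.
have E0 i j v : i != j -> v \in W j -> E i v = 0.
  move=> ij vj; rewrite EW daddv_pi_kernel //.
  by apply: (subvP (sumv_sup j _ (subvv _))) => //; rewrite eq_sym.
have Emem i v : E i v \in W i by rewrite EW memv_pi.
have limgE i : limg (E i) = W i.
  apply/vspaceP => v; apply/memv_imgP/idP => [[u _ ->]|vi]; first exact: Emem.
  by exists v; rewrite ?memvf ?Eid.
have W0 i : W i != 0%VS by rewrite (aP i).2; exact: (aP i).1.
have tha (i : 'I_d.+1) : th i = a i.
  rewrite thE -1?ltnS // inord_val limgE; apply: eigval_onE => // v.
  by rewrite memW => /eqP.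
split.
- move=> v; have /memv_sumP[u uW ->] := diagonalizable_span v Adiag Word.
  apply: eq_bigr => i _; rewrite linear_sum (bigD1 i) //= Eid ?uW //.
  by rewrite big1 ?addr0 // => j ji; rewrite (E0 _ j) ?uW // eq_sym.
- move=> i j v; case: eqP => [->|/eqP ij]; first exact: Eid.
  exact: (E0 _ j).
- by move=> i v; rewrite tha; apply/eqP; have := Emem i v; rewrite memW.
- move=> i j id jd; rewrite -[i]/(nat_of_ord (Ordinal (id : (i < d.+1)%N))).
  by rewrite -[j]/(nat_of_ord (Ordinal (jd : (j < d.+1)%N))) !tha => /a_inj ->.
- by move=> i; rewrite limgE.
move=> i j v ij.
have /(subvP (Wtri i)) : As (E i v) \in (As @: W i)%VS by rewrite memv_img.
case/memv_sumP => u uW ->; rewrite linear_sum big1 // => k kP.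
apply: (E0 _ k); last exact: uW.
by apply/eqP => jk; move: kP ij; rewrite jk; lia.
Qed.

Lemma spectral_of_td d (Phi : td_seq V d) :
  tridiagonal_system Phi -> spectral (td_A Phi) (td_As Phi) (td_E Phi) (theta Phi).
Proof.
move=> [[[Ad _] _ _ _] [W [Ws [WP _ EP _]]]].
exact: (spectral_of_ordering Ad WP EP).
Qed.

Lemma td_star_system d (Phi : td_seq V d) :
  tridiagonal_system Phi -> tridiagonal_system (td_star Phi).
Proof.
move=> [[[Ad Asd] Wex Wsex irr] [W [Ws [WP WsP EP EsP]]]]; split.
  by split=> // U UAs UA; apply: irr.
by exists Ws, W.
Qed.

Lemma td_Down_system d (Phi : td_seq V d) :
  tridiagonal_system Phi -> tridiagonal_system (td_Down Phi).
Proof.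
move=> [tdp [W [Ws [WP WsP EP EsP]]]]; split=> //.
exists (fun i => W (rev_ord i)), Ws; split=> //.
- case: WP => [[W_inj Wval Wall] Wtri]; split.
    split=> [i j /W_inj /rev_ord_inj //|i|a /Wall[i Wi]]; first exact: Wval.
    by exists (rev_ord i); rewrite rev_ordK.
  move=> i; apply: subv_trans (Wtri (rev_ord i)) _.
  apply/subv_sumP => j ij; rewrite -{1}[j]rev_ordK; apply: sumv_sup (subvv _).
  by move: ij (ltn_ord i) (ltn_ord j); rewrite /=; lia.
move=> i; rewrite /= EP; congr daddv_pi.
rewrite [RHS](reindex_inj rev_ord_inj) /=.
by apply: eq_big => j; rewrite ?rev_ordK // -(inj_eq rev_ord_inj) rev_ordK.
Qed.

(** This is why only two of the three operations have to be studied. *)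
Lemma td_down_conj d (Phi : td_seq V d) :
  td_down Phi = td_star (td_Down (td_star Phi)).
Proof. by []. Qed.

End SpectralOfOrdering.

(** * The split filtrations *)

Section SplitFiltration.

Variables (F : fieldType) (V : vectType F) (d : nat).
Variables (A As : 'End(V)) (E Es : 'I_d.+1 -> 'End(V)) (th : nat -> F).
Hypothesis spA : spectral A As E th.

(** Membership in the sum of the first i eigenspaces of As, and in the sum of the
    eigenspaces of A from the i-th on. The vectors that are both low i.+1 and
    high i form the i-th component of the split decomposition. *)
Definition low i v := forall j : 'I_d.+1, (i <= j)%N -> Es j v = 0.
Definition high i v := forall j : 'I_d.+1, (j < i)%N -> E j v = 0.

Lemma spectral_comm i v : E i (A v) = th i *: E i v.
Proof.
rewrite -[v in LHS](spectral_sum spA) !linear_sum (bigD1 i) //= big1.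
  by rewrite addr0 (spectral_eigen spA) linearZ /= (spectral_proj spA) eqxx.
move=> j ji; rewrite (spectral_eigen spA) linearZ /= (spectral_proj spA).
by rewrite eq_sym (negPf ji) scaler0.
Qed.

Lemma high_raise i v : high i v -> high i.+1 (A v - th i *: v).
Proof.
move=> hv j ji; rewrite linearB linearZ /= spectral_comm -scalerBl.
move: ji; rewrite ltnS leq_eqVlt => /orP[/eqP-> | /hv->]; last by rewrite scaler0.
by rewrite subrr scale0r.
Qed.

Lemma high_lower i c v : high i.+1 v -> high i (As v - c *: v).
Proof.
move=> hv j ji; rewrite linearB linearZ /= (hv j (ltnW _)) // scaler0 subr0.
rewrite -[v](spectral_sum spA) !linear_sum big1 //= => k _.
have [ki|ik] := ltnP k i.+1; first by rewrite (hv k) // !linear0.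
by apply: (spectral_tridiag spA); rewrite (leq_ltn_trans ji ik) orbT.
Qed.

Lemma highW i j v : (i <= j)%N -> high j v -> high i v.
Proof. by move=> ij hv k ki; apply: hv; apply: leq_trans ki ij. Qed.

Lemma highZB i a u v : high i u -> high i v -> high i (u - a *: v).
Proof. by move=> hu hv j ji; rewrite linearB linearZ /= hu // hv // scaler0 subr0. Qed.

Lemma high_eq0 v : high d.+1 v -> v = 0.
Proof. by move=> hv; rewrite -[v](spectral_sum spA) big1 // => i _; apply: hv. Qed.

Lemma high_shifts m c s v :
  high (m + size s) v -> high m (shifts As c s v).
Proof.
elim: s m => [|j s IHs] m; first by rewrite addn0 /shifts /= id_lfunE.
rewrite /= addnS -addSn => /IHs hv; rewrite shifts_cons; exact: high_lower.
Qed.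

(** Replacing one factor As - c by As - c' changes the vector by a scalar multiple
    of a product with one factor less, and such a product does not yet reach the
    eigenspace of A with index 0. *)
Lemma high_shifts_indep c c' s s' v : size s = size s' ->
  high (size s) v -> high 1 (shifts As c s v - shifts As c' s' v).
Proof.
move=> ss'; suff H m : high (m + size s) v ->
    high m.+1 (shifts As c s v - shifts As c' s' v).
  by move=> hv; apply: H.
elim: s s' ss' m => [|j s IHs] [|j' s'] //= ss' m.
  by rewrite /shifts /= id_lfunE subrr => _ i _; rewrite linear0.
have {}ss' := succn_inj ss'; rewrite addnS -addSn => hv.
have ih := IHs s' ss' _ hv.
have hs' : high m.+1 (shifts As c' s' v) by apply: high_shifts; rewrite -ss'.
have -> : shifts As c (j :: s) v - shifts As c' (j' :: s') v =
    (As (shifts As c s v - shifts As c' s' v) -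
       c j *: (shifts As c s v - shifts As c' s' v)) -
    (c j - c' j') *: shifts As c' s' v.
  have telescope (a b x y z : V) : a - x - (b - z) = a - b - (x - y) - (y - z).
    rewrite !opprB -[RHS]addrA [X in _ = _ + X]addrC subrKA addrACA [RHS]addrACA.
    by rewrite [- x - b]addrC.
  by rewrite !shifts_cons (linearB As) scalerBr scalerBl; apply: telescope.
by apply: highZB => //; apply: high_lower.
Qed.

Lemma spectral_coeff c s v : shifts A c s v =
  \sum_(i < d.+1) (\prod_(h <- s) (th i - c h)) *: E i v.
Proof.
rewrite -[v in LHS](spectral_sum spA) linear_sum; apply: eq_bigr => i _.
exact: shifts_eigen (spectral_eigen spA _ _).
Qed.

End SplitFiltration.

Section Low.

Variables (F : fieldType) (V : vectType F) (d : nat).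
Variables (A As : 'End(V)) (E Es : 'I_d.+1 -> 'End(V)) (th ths : nat -> F).
Hypothesis spA : spectral A As E th.
Hypothesis spAs : spectral As A Es ths.

Lemma low_raise i c v : low Es i v -> low Es i.+1 (A v - c *: v).
Proof.
move=> lv j ij; rewrite linearB linearZ /= (lv j (ltnW ij)) scaler0 subr0.
rewrite -[v](spectral_sum spAs) !linear_sum big1 //= => k _.
have [ik|ki] := leqP i k; first by rewrite (lv k) // !linear0.
by apply: (spectral_tridiag spAs); rewrite (leq_ltn_trans ki ij).
Qed.

Lemma low_lower i v : low Es i.+1 v -> low Es i (As v - ths i *: v).
Proof.
move=> lv j ij; rewrite linearB linearZ /= (spectral_comm spAs) -scalerBl.
move: ij; rewrite leq_eqVlt => /orP[/eqP-> | /lv->]; last by rewrite scaler0.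
by rewrite subrr scale0r.
Qed.

Lemma low0_eq0 v : low Es 0 v -> v = 0.
Proof. by move=> lv; rewrite -[v](spectral_sum spAs) big1 // => i _; apply: lv. Qed.

Hypothesis irreducible : forall U : {vspace V},
  (A @: U <= U)%VS -> (As @: U <= U)%VS -> U = 0%VS \/ U = fullv.

(** The vectors that are both low i.+1 and high i.+1 for some i span a subspace
    invariant under A, which raises both indices, and under As, which lowers
    both. It lies in the sum of the eigenspaces of A of positive index, which is
    not the whole space, so by irreducibility it is zero. *)
Lemma low1_high1_eq0 v : low Es 1 v -> high E 1 v -> v = 0.
Proof.
pose lowV i := (\bigcap_(j < d.+1 | (i <= j)%N) lker (Es j))%VS.
pose highV i := (\bigcap_(j < d.+1 | (j < i)%N) lker (E j))%VS.
have lowP i u : reflect (low Es i u) (u \in lowV i).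
  apply: (iffP idP) => [ul j ij|lu].
    by apply/eqP; rewrite -memv_ker; apply: (subvP _ _ ul); exact: (bigcapv_inf j).
  rewrite memvE; apply/subv_bigcapP => j ij.
  by rewrite -memvE memv_ker lu.
have highP i u : reflect (high E i u) (u \in highV i).
  apply: (iffP idP) => [ul j ij|lu].
    by apply/eqP; rewrite -memv_ker; apply: (subvP _ _ ul); exact: (bigcapv_inf j).
  rewrite memvE; apply/subv_bigcapP => j ij.
  by rewrite -memvE memv_ker lu.
pose W := (\sum_(i < d.+1) (lowV i.+1 :&: highV i.+1))%VS.
have memW i u : low Es i.+1 u -> high E i.+1 u -> u \in W.
  move=> lu hu; have [id|di] := ltnP i d.+1; last first.
    by rewrite (high_eq0 spA (v := u)) ?mem0v //; apply: highW hu; lia.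
  apply: (subvP (sumv_sup (Ordinal id) _ (subvv _))) => //=.
  by rewrite memv_cap; apply/andP; split; [apply/lowP | apply/highP].
have AW : (A @: W <= W)%VS.
  rewrite limg_sum; apply/subv_sumP => i _; apply/subvP => _ /memv_imgP[u + ->].
  rewrite memv_cap => /andP[/lowP lu /highP hu].
  rewrite -(subrK (th i.+1 *: u) (A u)) memvD ?memvZ //; last exact: memW lu hu.
  by apply: memW (low_raise _ lu) (high_raise spA hu).
have AsW : (As @: W <= W)%VS.
  rewrite limg_sum; apply/subv_sumP => -[[|i] id] _; apply/subvP => _ /memv_imgP[u + ->].
    rewrite memv_cap => /andP[/lowP lu /highP hu].
    rewrite -(subrK (ths 0%N *: u) (As u)) (low0_eq0 (low_lower lu)) add0r.
    by rewrite memvZ //; apply: memW lu hu.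
  rewrite memv_cap => /andP[/lowP lu /highP hu].
  rewrite -(subrK (ths i.+1 *: u) (As u)) memvD ?memvZ //; last exact: memW lu hu.
  by apply: memW (low_lower lu) (high_lower spA _ hu).
have W1 : (W <= highV 1)%VS.
  apply/subv_sumP => i _; apply/subvP => u; rewrite memv_cap => /andP[_ /highP hu].
  by apply/highP; apply: highW hu.
move=> lv hv; have := memW 0%N v lv hv.
case: (irreducible AW AsW) => [-> | WT _]; first by rewrite memv0 => /eqP.
case/eqP: (spectral_neq0 spA ord0); apply/eqP; rewrite -subv0.
apply/subvP => _ /memv_imgP[u _ ->]; rewrite memv0; apply/eqP.
have /highP : u \in highV 1 by apply: (subvP W1); rewrite WT memvf.
exact.
Qed.

Lemma E0_neq0 v : low Es 1 v -> v != 0 -> E ord0 v != 0.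
Proof.
move=> lv; apply: contra_neq => E0v; apply: low1_high1_eq0 => // j.
by rewrite ltnS leqn0 => /eqP j0; rewrite (_ : j = ord0) //; apply: val_inj.
Qed.

Lemma low1P v : reflect (low Es 1 v) (v \in limg (Es ord0)).
Proof.
apply: (iffP memv_imgP) => [[u _ ->] j j1|lv].
  by rewrite (spectral_proj spAs); case: eqP j1 => // ->.
exists v; rewrite ?memvf // -{1}[v](spectral_sum spAs) (bigD1 ord0) //= big1 ?addr0 //.
by move=> j j0; apply: lv; rewrite lt0n.
Qed.

(** By irreducibility E_0 is injective on the range of Es_0. *)
Lemma dim_extreme_le : (\dim (limg (Es ord0)) <= \dim (limg (E ord0)))%N.
Proof.
rewrite -(@limg_dim_eq _ _ _ (E ord0) (limg (Es ord0))).
  by apply: dimvS; apply: limgS; apply: subvf.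
apply/eqP; rewrite -subv0; apply/subvP => v; rewrite memv_cap memv_ker memv0.
move=> /andP[/low1P lv]; apply: contraTT; exact: E0_neq0.
Qed.

End Low.

(** * The split scalars zeta *)

Section SplitScalars.

Variables (F : fieldType) (V : vectType F) (d : nat).
Implicit Types (Phi : td_seq V d).

Lemma eigval_on_line (f : 'End(V)) (U : {vspace V}) :
  \dim U = 1%N -> (forall u, u \in U -> f u \in U) ->
  forall u, u \in U -> f u = eigval_on f U *: u.
Proof.
move=> dimU fU.
have U0 : U != 0%VS by rewrite -dimv_eq0 dimU.
have UE : U = <[vpick U]>%VS.
  apply/eqP; rewrite eq_sym eqEdim dimU dim_vline vpick0 U0 andbT.
  by rewrite -memvE memv_pick.
have /fU := memv_pick U; rewrite {2}UE => /vlineP[c fc].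
have fE u : u \in U -> f u = c *: u.
  by rewrite {1}UE => /vlineP[a ->]; rewrite linearZ /= fc !scalerA mulrC.
by rewrite (eigval_onE U0 fE).
Qed.

Lemma prod_iota (c : F) (a : nat -> F) m n :
  \prod_(j <- iota m n) (c - a j) = \prod_(m <= j < m + n) (c - a j).
Proof. by rewrite /index_iota addKn. Qed.

Lemma prod_rev_iota (c : F) (a : nat -> F) n :
  \prod_(j <- rev (iota 0 n)) (c - a j) = \prod_(0 <= j < n) (c - a j).
Proof. by rewrite /index_iota subn0; apply: perm_big; rewrite perm_rev. Qed.

Lemma td_irreducible Phi : tridiagonal_system Phi ->
  forall U : {vspace V}, (td_A Phi @: U <= U)%VS -> (td_As Phi @: U <= U)%VS ->
    U = 0%VS \/ U = fullv.
Proof. by case=> [[]]. Qed.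

Lemma sharp_star Phi : tridiagonal_system Phi -> sharp Phi -> sharp (td_star Phi).
Proof.
move=> tdP; have tdS := td_star_system tdP.
rewrite /sharp /= => dimE; apply/eqP; rewrite eqn_leq -{1}dimE.
have spA := spectral_of_td tdP; have spAs := spectral_of_td tdS.
rewrite (dim_extreme_le spA spAs (td_irreducible tdP)) lt0n dimv_eq0.
exact: spectral_neq0 spAs _.
Qed.

Lemma sharp_Down Phi : tridiagonal_system Phi -> sharp Phi -> sharp (td_Down Phi).
Proof.
move=> tdP sh; have tdD := td_Down_system tdP.
have tdDs := td_star_system tdD.
have := sharp_star tdP sh; rewrite /sharp /= => dimEs.
apply/eqP; rewrite eqn_leq -{1}dimEs.
have spA := spectral_of_td tdDs; have spAs := spectral_of_td (td_star_system tdDs).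
rewrite (dim_extreme_le spA spAs (td_irreducible tdDs)) lt0n dimv_eq0.
exact: spectral_neq0 spAs _.
Qed.

(** The masses of the spectral measure of A on the line of Es_0. *)
Definition spectral_mass Phi (k : 'I_d.+1) : F :=
  eigval_on (td_Es Phi ord0 \o td_E Phi k)%VF (limg (td_Es Phi ord0)).

Section OneSystem.

Variable Phi : td_seq V d.
Hypotheses (tdP : tridiagonal_system Phi) (shP : sharp Phi).

Let A := td_A Phi.
Let As := td_As Phi.
Let E := td_E Phi.
Let Es := td_Es Phi.
Let th := theta Phi.
Let ths := thetas Phi.

Let spA : spectral A As E th := spectral_of_td tdP.
Let spAs : spectral As A Es ths := spectral_of_td (td_star_system tdP).

(** tau_i(A) v. *)
Definition tau_vector i v := shifts A th (rev (iota 0 i)) v.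

Lemma tau_vectorS i v :
  tau_vector i.+1 v = A (tau_vector i v) - th i *: tau_vector i v.
Proof. by rewrite /tau_vector -[in LHS]addn1 iotaD rev_cat /= shifts_cons. Qed.

Lemma tau_vector_split i v :
  low Es 1 v -> low Es i.+1 (tau_vector i v) /\ high E i (tau_vector i v).
Proof.
move=> lv; elim: i => [|i [lr hr]].
  by rewrite /tau_vector /shifts /= id_lfunE; split.
rewrite tau_vectorS; split; first exact: (low_raise spAs).
exact: (high_raise spA).
Qed.

Lemma zeta_mapE i v : zeta_map Phi i v = shifts As ths (iota 1 i) (tau_vector i v).
Proof. exact: comp_list_cat. Qed.

Lemma zeta_map_Es0 i v : low Es 1 v ->
  zeta_map Phi i v =
  \prod_(1 <= j < i.+1) (ths 0%N - ths j) *: Es ord0 (tau_vector i v).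
Proof.
move=> lv; rewrite zeta_mapE (spectral_coeff spAs) (bigD1 ord0) //= prod_iota.
rewrite [X in _ + X]big1 ?addr0 // => j j0; have [ji|ij] := leqP j i; last first.
  by rewrite (tau_vector_split i lv).1 ?scaler0.
rewrite (_ : \prod_(_ <- _) _ = 0) ?scale0r //.
apply/eqP; rewrite prodf_seq_eq0; apply/hasP; exists (nat_of_ord j).
  by rewrite mem_iota lt0n j0 add1n ltnS ji.
by rewrite subrr eqxx.
Qed.

Lemma dim_Es0 : \dim (limg (Es ord0)) = 1%N.
Proof. exact: sharp_star tdP shP. Qed.

Lemma zeta_mapP i v : low Es 1 v -> zeta_map Phi i v = zeta Phi i *: v.
Proof.
move=> lv; apply: eigval_on_line dim_Es0 _ _ _; last exact/(low1P spAs).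
move=> u /(low1P spAs) lu; rewrite zeta_map_Es0 //.
by rewrite memvZ // memv_img // memvf.
Qed.

Lemma spectral_massP k v : low Es 1 v -> Es ord0 (E k v) = spectral_mass Phi k *: v.
Proof.
move=> lv; rewrite /spectral_mass -(eigval_on_line dim_Es0) ?comp_lfunE //.
  by move=> u _; rewrite comp_lfunE memv_img // memvf.
exact/(low1P spAs).
Qed.

Lemma low1_exists : exists2 v, low Es 1 v & v != 0.
Proof.
have U0 : limg (Es ord0) != 0%VS by rewrite -dimv_eq0 dim_Es0.
exists (vpick (limg (Es ord0))); last by rewrite vpick0.
by apply/(low1P spAs); rewrite memv_pick.
Qed.

(** This makes the dependence of zeta on the order of the E_i explicit: the
    masses are merely permuted, and the Newton polynomials tau_i change. *)
Lemma zeta_spectral_mass i :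
  zeta Phi i = \prod_(1 <= j < i.+1) (ths 0%N - ths j) *
    \sum_(k < d.+1) \prod_(0 <= h < i) (th k - th h) * spectral_mass Phi k.
Proof.
have [v lv v0] := low1_exists.
apply/eqP; rewrite -subr_eq0; have := zeta_mapP i lv.
rewrite zeta_map_Es0 // /tau_vector (spectral_coeff spA) (linear_sum (Es ord0)) /=.
under [X in _ *: X]eq_bigr => k _ do
  rewrite linearZ /= spectral_massP // scalerA prod_rev_iota.
rewrite -scaler_suml scalerA => /eqP; rewrite eq_sym -subr_eq0 -scalerBl.
by rewrite scaler_eq0 (negPf v0) orbF.
Qed.

(** Newton interpolation at the eigenvalues of A of the function that is 1 at
    th_0 and 0 elsewhere; its divided differences are the inverse products
    on the right. *)
Lemma E0_tau_vector v : E ord0 v =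
  \sum_(k < d.+1) (\prod_(1 <= j < k.+1) (th 0%N - th j))^-1 *: tau_vector k v.
Proof.
have th0 j : (0 < j <= d)%N -> th 0%N - th j != 0.
  move=> /andP[j0 jd]; rewrite subr_eq0; apply: contraTneq j0.
  by move=> /(spectral_inj spA (leq0n d) jd) <-.
have newton m x : (m <= d)%N ->
    \sum_(0 <= k < m.+1) (\prod_(1 <= j < k.+1) (th 0%N - th j))^-1 *
      \prod_(0 <= h < k) (x - th h) =
    \prod_(1 <= h < m.+1) ((x - th h) / (th 0%N - th h)).
  elim: m => [|m IHm] md; first by rewrite big_nat1 !big_geq // invr1 mulr1.
  rewrite big_nat_recr //= IHm 1?ltnW // [in RHS]big_nat_recr //= prodf_div.
  rewrite (@big_nat_recr _ _ _ m.+1 1) //= (@big_ltn _ _ _ 0) //.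
  have t1 : th 0%N - th m.+1 != 0 by apply: th0.
  have : \prod_(1 <= i < m.+1) (th 0%N - th i) != 0.
    rewrite big_nat_cond prodf_seq_neq0; apply/allP => i _.
    by apply/implyP => /andP[/andP[i0 im] _]; apply: th0; lia.
  set P := \prod_(1 <= i < m.+1) (th 0%N - th i) => P0.
  by field; rewrite P0 t1.
under eq_bigr => k _ do rewrite /tau_vector (spectral_coeff spA) scaler_sumr.
rewrite exchange_big /=.
transitivity (\sum_(i < d.+1) (i == ord0)%:R *: E i v).
  rewrite (bigD1 ord0) //= mulr1n scale1r big1 ?addr0 // => i /negPf ->.
  by rewrite scale0r.
apply: eq_bigr => i _.
under eq_bigr => k _ do rewrite scalerA prod_rev_iota.
rewrite -scaler_suml; congr (_ *: _).
rewrite -(big_mkord xpredT (fun k => (\prod_(1 <= j < k.+1) (th 0%N - th j))^-1 *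
   \prod_(0 <= h < k) (th i - th h))) newton //.
case: eqP => [->|/eqP i0].
  by rewrite big_nat_cond big1 // => h /andP[/andP[h0 hd] _]; rewrite divff // th0 // h0.
symmetry; apply/eqP; rewrite prodf_seq_eq0; apply/hasP; exists (nat_of_ord i).
  by rewrite mem_index_iota lt0n i0 ltn_ord.
by rewrite subrr mul0r eqxx.
Qed.

End OneSystem.

(** Let v span the range of Es_0 and u = E_0 v, which is nonzero. In the expansion
    of u along the tau_k(A) v, applying taus_i(As) and then E_0 kills the terms
    k < i, where taus_i vanishes on the eigenvalues involved, and the terms
    k > i, which i lowerings do not bring down to index 0. In the term k = i the
    order and the values of the i shifts do not matter
    ([high_shifts_indep]), so they may be taken as in the definition of zeta. *)
Lemma zeta_star Phi i : tridiagonal_system Phi -> sharp Phi -> (i <= d)%N ->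
  zeta (td_star Phi) i = zeta Phi i.
Proof.
move=> tdP shP id; have tdS := td_star_system tdP; have shS := sharp_star tdP shP.
have spA := spectral_of_td tdP; have spAs := spectral_of_td tdS.
have [v lv v0] := low1_exists tdP shP.
pose u := td_E Phi ord0 v.
have u0 : u != 0 := E0_neq0 spA spAs (td_irreducible tdP) lv v0.
have lu : low (td_E Phi) 1 u by apply/(low1P spA); rewrite memv_img ?memvf.
have E0high w : high (td_E Phi) 1 w -> td_E Phi ord0 w = 0 by apply.
pose s := rev (iota 0 i); have size_s : size s = i by rewrite size_rev size_iota.
have key k : td_E Phi ord0 (shifts (td_As Phi) (thetas Phi) s (tau_vector Phi k v)) =
    if k == i then zeta Phi i *: u else 0.
  have [lk hk] := tau_vector_split tdP k lv; case: eqP => [ki|/eqP ki].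
    rewrite /u -linearZ -(zeta_mapP tdP shP) // zeta_mapE -ki.
    apply/eqP; rewrite -subr_eq0 -linearB; apply/eqP; apply: E0high.
    by apply: (high_shifts_indep spA); rewrite ?size_s ?size_iota ?ki // -ki.
  have [ik|ki'] := ltnP i k.
    by apply: E0high; apply: (high_shifts spA); apply: highW hk; rewrite size_s.
  rewrite (spectral_coeff spAs) big1 ?linear0 // => j _.
  have [jk|kj] := leqP j k; last by rewrite lk ?scaler0.
  rewrite prod_rev_iota (_ : \prod_(0 <= h < i) _ = 0) ?scale0r //.
  apply/eqP; rewrite prodf_seq_eq0; apply/hasP; exists (nat_of_ord j).
    by rewrite mem_index_iota; lia.
  by rewrite subrr eqxx.
pose phi k := \prod_(1 <= j < k.+1) (theta Phi 0%N - theta Phi j).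
have phi0 : phi i != 0.
  rewrite /phi big_nat_cond prodf_seq_neq0; apply/allP => j _; apply/implyP.
  move=> /andP[/andP[j0 ji] _]; rewrite subr_eq0; apply: contraTneq j0 => e.
  by rewrite -(spectral_inj spA (leq0n d) _ e) //; lia.
have E0s : td_E Phi ord0 (shifts (td_As Phi) (thetas Phi) s u) =
    (phi i)^-1 *: (zeta Phi i *: u).
  transitivity (\sum_(k < d.+1) (phi k)^-1 *:
      td_E Phi ord0 (shifts (td_As Phi) (thetas Phi) s (tau_vector Phi k v))).
    rewrite {1}/u (E0_tau_vector tdP v) (linear_sum (shifts _ _ _)).
    rewrite (linear_sum (td_E Phi ord0)).
    by apply: eq_bigr => k _; rewrite !linearZ.
  rewrite (bigD1 (Ordinal (id : (i < d.+1)%N))) //= key eqxx big1 ?addr0 // => k ki.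
  rewrite key; case: eqP => [e|_]; last by rewrite scaler0.
  by case/eqP: ki; apply: val_inj.
have := zeta_mapP tdS shS i lu; rewrite (zeta_map_Es0 tdS i lu) /= /tau_vector E0s.
rewrite scalerA divff // scale1r => /eqP; rewrite -subr_eq0 -scalerBl scaler_eq0.
by rewrite (negPf u0) orbF subr_eq0 => /eqP.
Qed.

End SplitScalars.

(** * The coefficients alpha and the types *)

Section TypeCases.

Variables (F : fieldType) (Fbar : closedFieldType) (iota : {rmorphism F -> Fbar}).
Implicit Types (t ts alpha : nat -> F) (beta : F) (d : nat).

(** The value of q^2n + q^-2n as a polynomial in beta. It shows that the alpha_i
    lie in the base field and do not depend on the choice of q. *)
Definition lucas beta n : F :=
  (iter n (fun p : F * F => (p.2, beta * p.2 - p.1)) (2, beta)).1.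

Lemma lucasE beta (Q : Fbar) n : Q != 0 -> Q + Q^-1 = iota beta ->
  iota (lucas beta n) = Q ^+ n + Q ^- n.
Proof.
move=> Q0 Qb.
have step m : lucas beta m.+2 = beta * lucas beta m.+1 - lucas beta m by [].
have [] : iota (lucas beta n) = Q ^+ n + Q ^- n /\
    iota (lucas beta n.+1) = Q ^+ n.+1 + Q ^- n.+1; last by [].
elim: n => [|n [IH0 IH1]].
  by rewrite /lucas /= rmorph_nat expr0 invr1 expr1 Qb.
split=> //; rewrite step rmorphB rmorphM IH0 IH1 -Qb !exprS.
by have := expf_neq0 n Q0; move: (Q ^+ n) => z z0; field; apply/andP.
Qed.

Definition alpha_of beta d i : F :=
  match type_of beta d with
  | TypeI => (lucas beta i - 2) / (lucas beta d - 2)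
  | TypeII => i%:R ^+ 2 / d%:R ^+ 2
  | _ => parity F i
  end.

Lemma q_number_sqr (q : Fbar) beta n : q != 0 -> q ^+ 2 + q ^- 2 = iota beta ->
  (q ^+ n - q ^- n) ^+ 2 = iota (lucas beta n - 2).
Proof.
move=> q0 qb; rewrite rmorphB (lucasE n _ qb) ?expf_neq0 // rmorph_nat.
rewrite -!exprM mulnC exprM.
by have := expf_neq0 n q0; move: (q ^+ n) => z z0; field.
Qed.

Lemma is_alpha_unique beta d alpha : is_alpha iota beta d alpha ->
  forall i, (0 < i <= d)%N -> alpha i = alpha_of beta d i.
Proof.
rewrite /is_alpha /alpha_of; case: type_of => //.
move=> [q [q0 qb alE]] i id; apply: (fmorph_inj iota).
by rewrite alE // fmorph_div !(q_number_sqr _ q0 qb).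
Qed.

Lemma is_alpha_of beta d : type_of beta d <> TypeIIIplus ->
  is_alpha iota beta d (alpha_of beta d).
Proof.
rewrite /is_alpha /alpha_of; case: type_of => // _.
have [q qE] := @solve_monicpoly Fbar 4 (fun i => if i == 0%N then -1 else
   if i == 2%N then iota beta else 0) isT.
have q0 : q != 0.
  apply/eqP => q0; move: qE; rewrite q0 !big_ord_recl big_ord0 /= !expr0n /=.
  by rewrite !(mulr0, addr0, mulr1) => /eqP; rewrite eq_sym oppr_eq0 oner_eq0.
have qb : q ^+ 2 + q ^- 2 = iota beta.
  move: qE; rewrite !big_ord_recl big_ord0 /= => qE.
  rewrite (_ : iota beta = (q ^+ 4 + 1) / q ^+ 2); first by field.
  by rewrite qE /bump /=; field.
exists q; split=> // i id.
by rewrite fmorph_div !(q_number_sqr _ q0 qb).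
Qed.

Definition injective_upto d t :=
  forall i j, (i <= d)%N -> (j <= d)%N -> t i = t j -> i = j.

(** Distinctness of the eigenvalues gives q^2i <> 1 for 1 <= i <= d, because
    q^2i = 1 would make the i-th eigenvalue equal to the 0-th. *)
Lemma q_saalschutz_data (q : Fbar) beta d alpha t ts :
  q != 0 -> q ^+ 2 + q ^- 2 = iota beta -> beta != 2 -> beta != - 2 ->
  (forall i, (0 < i <= d)%N ->
     iota (alpha i) = (q ^+ i - q ^- i) ^+ 2 / (q ^+ d - q ^- d) ^+ 2) ->
  recurrent beta d t -> recurrent beta d ts -> injective_upto d t ->
  saalschutz_data alpha t ts d alpha.
Proof.
move=> q0 qb b2 bN2 alE rt rts t_inj.
pose Q := q ^+ 2; have Q0 : Q != 0 by rewrite expf_neq0.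
have Q1 : Q != 1.
  apply: contra_neq b2 => Q1; apply: (fmorph_inj iota).
  by rewrite -qb -/Q Q1 invr1 rmorph_nat.
have QN1 : Q != -1.
  apply: contra_neq bN2 => QN; apply: (fmorph_inj iota).
  by rewrite -qb -/Q QN invrN1 rmorphN rmorph_nat -opprD.
have rec_iota u : recurrent beta d u -> recurrent (Q + Q^-1) d (iota \o u).
  move=> ru i id; rewrite /= -!rmorphB ru // (rmorphM iota) (rmorphD iota) (rmorph1 iota).
  by rewrite -qb.
have [x [y tE]] := recurrent_q_sequence Q0 Q1 QN1 (rec_iota t rt).
have [xs [ys tsE]] := recurrent_q_sequence Q0 Q1 QN1 (rec_iota ts rts).
have Qn n : (0 < n <= d)%N -> Q ^+ n != 1.
  move=> /andP[n0 nd]; apply: contraTneq n0 => Qn1.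
  have := tE n nd; rewrite Qn1 invr1 subrr !mulr0 !addr0 => /fmorph_inj.
  by move/(t_inj n 0%N nd (leq0n d)) ->.
have sqrE n : (q ^+ n - q ^- n) ^+ 2 = (Q ^+ n - 1) ^+ 2 / Q ^+ n.
  rewrite -exprM mulnC exprM.
  by have := expf_neq0 n q0; move: (q ^+ n) => z z0; field.
have sqr0 n : (0 < n <= d)%N -> (Q ^+ n - 1) ^+ 2 / Q ^+ n != 0.
  by move=> nd; rewrite mulf_neq0 ?invr_eq0 ?expf_neq0 // subr_eq0 Qn.
pose c := (q ^+ d - q ^- d) ^+ 2.
have c0 : (0 < d)%N -> c != 0 by move=> d0; rewrite /c sqrE sqr0 // d0 leqnn.
apply: saalschutz_data_residue.
- move=> i id; rewrite -(fmorph_eq0 iota) alE // mulf_neq0 ?invr_eq0 ?c0 //; last lia.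
  by rewrite sqrE sqr0.
- move=> d0; apply: (fmorph_inj iota).
  by rewrite alE ?d0 ?leqnn // divff ?c0 // rmorph1.
have residue_iota a n : iota (residue alpha t ts a n) =
    residue (iota \o alpha) (iota \o t) (iota \o ts) a n.
  by rewrite /residue rmorphD !rmorphM !fmorphV !rmorphB.
move=> a n an; apply: (fmorph_inj iota); rewrite !residue_iota.
have d0 : (0 < d)%N by lia.
have residueE := residue_q_sequence Q0 (c0 d0) Qn tE tsE.
rewrite !residueE ?leqnn ?andbT //; try lia; move=> k kd; rewrite /= alE // sqrE //.
Qed.

Lemma quadratic_saalschutz_data d t ts alpha :
  (2 : F) != 0 -> (forall i, (0 < i <= d)%N -> alpha i = i%:R ^+ 2 / d%:R ^+ 2) ->
  recurrent 2 d t -> recurrent 2 d ts -> injective_upto d t ->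
  saalschutz_data alpha t ts d alpha.
Proof.
move=> two0 alE rt rts t_inj.
have [x [y tE]] := recurrent_quadratic two0 rt.
have [xs [ys tsE]] := recurrent_quadratic two0 rts.
have nz n : (0 < n <= d)%N -> n%:R != 0 :> F.
  move=> /andP[n0 nd]; apply: contraTneq n0 => n0.
  have := tE n nd; rewrite n0 expr0n /= !mulr0 !addr0.
  by move/(t_inj n 0%N nd (leq0n d)) ->.
have d20 : (0 < d)%N -> d%:R ^+ 2 != 0 :> F.
  by move=> d0; rewrite expf_neq0 // nz // d0 leqnn.
apply: saalschutz_data_residue.
- move=> i id; rewrite alE // mulf_neq0 ?invr_eq0 ?d20 ?expf_neq0 ?nz //; lia.
- by move=> d0; rewrite alE ?d0 ?leqnn // divff ?d20.
move=> a n an; have d0 : (0 < d)%N by lia.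
by rewrite !(residue_quadratic (d20 d0) nz tE tsE alE) //; lia.
Qed.

(** If m vanished in F, the terms of index 2m and 0 would coincide. *)
Lemma alternating_neq0 d t h : alternating_sequence d t h -> injective_upto d t ->
  forall m, (0 < m)%N -> (m.*2 <= d)%N -> m%:R != 0 :> F.
Proof.
move=> tE t_inj m m0 md; apply: contraTneq m0 => m0.
have := (tE m).1 md; rewrite m0 mul0r addr0.
by move/(t_inj m.*2 0%N md (leq0n d)); case: m {md m0}.
Qed.

(** Type IV is treated as type III-: in characteristic 2 the base 0 equals -2, and
    d must be 3 since otherwise the eigenvalues of index 0 and 4 coincide. *)
Lemma saalschutz_data_of_type beta d alpha :
  is_alpha iota beta d alpha -> ((d < 3)%N -> beta != 0) ->
  exists w, forall t ts, recurrent beta d t -> recurrent beta d ts ->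
    injective_upto d t -> saalschutz_data alpha t ts d w.
Proof.
rewrite /is_alpha /type_of.
case: ifP => [/andP[b2 bN2] [q [q0 qb alE]] _ | bI].
  by exists alpha => t ts; apply: (q_saalschutz_data q0 qb b2 bN2 alE).
have two0 : 2 \notin [pchar F] -> (2 : F) != 0 by rewrite inE.
case: ifP => [c2 alE b0 | /negbT/two0 {}two0].
  exists (parity_weight F) => t ts rt rts t_inj.
  have {c2} two0 : (2 : F) = 0 by apply/eqP; move: c2; rewrite inE.
  move: bI; rewrite two0 oppr0 andbb => /negbFE/eqP beta0.
  have d3 : (3 <= d)%N by rewrite leqNgt; apply/negP => /b0; rewrite beta0 eqxx.
  rewrite (_ : beta = - 2) in rt rts; last by rewrite two0 oppr0.
  have [h tE] := recurrent_alternating rt; have [hs tsE] := recurrent_alternating rts.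
  have nz := alternating_neq0 tE t_inj.
  have dle : (d < 4)%N.
    by rewrite ltnNge; apply/negP => d4; have := nz 2%N isT d4; rewrite two0 eqxx.
  have d_odd : odd d by rewrite (_ : d = 3%N) //; lia.
  exact: saalschutz_data_alternating d_odd nz tE tsE alE.
case: ifP => [/eqP-> alE _ | bneq2].
  by exists alpha => t ts; apply: quadratic_saalschutz_data.
have {bI bneq2} -> : beta = - 2 by move: bI; rewrite bneq2 => /negbFE/eqP.
case: ifP => // d_odd alE _; exists (parity_weight F) => t ts rt rts t_inj.
have [h tE] := recurrent_alternating rt; have [hs tsE] := recurrent_alternating rts.
exact: saalschutz_data_alternating d_odd (alternating_neq0 tE t_inj) tE tsE alE.
Qed.

End TypeCases.

(** * Invariance of the Drinfel'd polynomial *)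

Section DrinfeldOfSystem.

Variables (F : fieldType) (V : vectType F) (d : nat).
Implicit Types (Phi Psi : td_seq V d) (alpha : nat -> F).

Definition zeta_sum alpha Phi : {poly F} :=
  \sum_(0 <= i < d.+1)
     zeta Phi i *: \prod_(i.+1 <= j < d.+1) p_factor alpha Phi j.

Lemma zeta_sum_kernel alpha Phi : tridiagonal_system Phi -> sharp Phi ->
  zeta_sum alpha Phi =
  \sum_(k < d.+1) spectral_mass Phi k *: kernel alpha (theta Phi) (thetas Phi) d k.
Proof.
move=> tdP shP; rewrite /zeta_sum /kernel.
under [RHS]eq_bigr => k _ do rewrite scaler_sumr.
rewrite [RHS]exchange_big /=; apply: eq_bigr => i _.
rewrite zeta_spectral_mass // mulr_sumr scaler_suml; apply: eq_bigr => k _.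
by rewrite scalerA; congr (_ *: _); rewrite mulrA mulrC.
Qed.

Lemma theta_Down Phi i :
  (i <= d)%N -> theta (td_Down Phi) i = reversal d (theta Phi) i.
Proof.
move=> id; rewrite /reversal /theta /=; congr (eigval_on _ (limg (td_E Phi _))).
by apply: val_inj; rewrite /= !inordK ?ltnS ?leq_subr // subSS.
Qed.

Lemma corner_star Phi : corner (td_star Phi) = corner Phi.
Proof.
rewrite -[LHS]/(corner_seq (thetas Phi) (theta Phi) d).
rewrite -[RHS]/(corner_seq (theta Phi) (thetas Phi) d) /corner_seq.
by rewrite [X in X%:P]addrC [thetas Phi d * _]mulrC [thetas Phi 0%N * _]mulrC.
Qed.

Lemma p_factor_star alpha Phi i :
  p_factor alpha (td_star Phi) i = p_factor alpha Phi i.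
Proof.
by rewrite /p_factor corner_star /gap mulrC.
Qed.

Lemma zeta_sum_star alpha Phi : tridiagonal_system Phi -> sharp Phi ->
  zeta_sum alpha (td_star Phi) = zeta_sum alpha Phi.
Proof.
move=> tdP shP; rewrite /zeta_sum; apply: eq_big_nat => i /andP[_ id].
rewrite zeta_star //; congr (_ *: _).
by apply: eq_bigr => j _; apply: p_factor_star.
Qed.

Lemma kernel_congr alpha (t u ts : nat -> F) k :
  (forall i, (i <= d)%N -> t i = u i) -> (k <= d)%N ->
  kernel alpha t ts d k = kernel alpha u ts d k.
Proof.
move=> tu kd; rewrite /kernel; apply: eq_big_nat => i /andP[_ id].
congr (_ * _ *: _).
  by apply: eq_big_nat => h /andP[_ hi]; rewrite !tu //; lia.
by apply: eq_big_nat => j /andP[_ jd]; rewrite /factor_seq /corner_seq !tu.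
Qed.

Lemma zeta_sum_Down alpha Phi w : tridiagonal_system Phi -> sharp Phi ->
  saalschutz_data alpha (theta Phi) (thetas Phi) d w ->
  saalschutz_data alpha (reversal d (theta Phi)) (thetas Phi) d w ->
  zeta_sum alpha (td_Down Phi) = zeta_sum alpha Phi.
Proof.
move=> tdP shP sdata data_rev.
have [tdD shD] := (td_Down_system tdP, sharp_Down tdP shP).
rewrite !zeta_sum_kernel // (reindex_inj rev_ord_inj) /=.
apply: eq_bigr => k _; rewrite -[X in _ = X *: _]/(spectral_mass Phi k).
rewrite (kernel_reversal sdata data_rev) -1?ltnS //; congr (_ *: _).
  by rewrite /spectral_mass /= rev_ordK.
by rewrite subSS; apply: kernel_congr (theta_Down Phi) (leq_subr _ _).
Qed.

Lemma prod_IIIplus_star Phi :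
  \prod_(1 <= i < d.+1) p_factor_IIIplus (td_star Phi) i =
  \prod_(1 <= i < d.+1) p_factor_IIIplus Phi i.
Proof.
by apply: eq_bigr => i _; rewrite /p_factor_IIIplus corner_star /gap [X in X%:P]mulrC.
Qed.

Lemma prod_IIIplus_Down Phi : ~~ odd d -> (2 : F) != 0 ->
  recurrent (- 2) d (theta Phi) -> recurrent (- 2) d (thetas Phi) ->
  injective_upto d (theta Phi) ->
  \prod_(1 <= i < d.+1) p_factor_IIIplus (td_Down Phi) i =
  \prod_(1 <= i < d.+1) p_factor_IIIplus Phi i.
Proof.
move=> d_even two0 rt rts t_inj.
have [h tE] := recurrent_alternating rt; have [hs sE] := recurrent_alternating rts.
have [h' rtE] := recurrent_alternating (recurrent_reversal rt).
have nz := alternating_neq0 tE t_inj.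
have dD : d = d./2.*2 by rewrite -[LHS]odd_double_half (negPf d_even).
have D0 : (0 < d./2)%N -> d./2%:R != 0 :> F by move=> D0; apply: nz; rewrite -?dD //.
transitivity (\prod_(1 <= i < d.+1)
    factor_IIIplus (reversal d (theta Phi)) (thetas Phi) d i).
  apply: eq_big_nat => i /andP[_ id].
  by rewrite /p_factor_IIIplus /factor_IIIplus /corner /corner_seq /gap !theta_Down.
transitivity (\prod_(1 <= i < d.+1) factor_IIIplus (theta Phi) (thetas Phi) d i) => //.
rewrite (prod_factor_IIIplus dD two0 D0 tE sE).
rewrite (prod_factor_IIIplus dD two0 D0 rtE sE); congr (_ *: _ ^+ _).
rewrite mulrC; congr (_ * _).
by rewrite /corner_seq /reversal !subKn.
Qed.

Lemma is_base_recurrent beta Phi : tridiagonal_system Phi ->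
  is_base Phi beta <->
  [/\ (d < 3)%N -> beta != 0, recurrent beta d (theta Phi)
    & recurrent beta d (thetas Phi)].
Proof.
move=> tdP; have inj_th := spectral_inj (spectral_of_td tdP).
have inj_ths := spectral_inj (spectral_of_td (td_star_system tdP)).
rewrite /is_base; case: ifP => [d3 | /negbT]; last first.
  rewrite -ltnNge => d3; split=> [b0 | [b0 _ _]]; last exact: b0.
  by split=> // i id; lia.
have ratioE (t : nat -> F) i : injective_upto d t -> (i + 3 <= d)%N ->
    (t i - t i.+3) / (t i.+1 - t i.+2) = beta + 1 <->
    t i - t i.+3 = (beta + 1) * (t i.+1 - t i.+2).
  move=> t_inj id; have t0 : t i.+1 - t i.+2 != 0.
    by rewrite subr_eq0; apply/eqP => /t_inj e; have := e ltac:(lia) ltac:(lia); lia.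
  by split=> [<-|->]; rewrite ?divfK ?mulfK.
split=> [base | [_ rt rts] [|[|i]] // id].
  split=> [|i id|i id]; first by rewrite ltnNge d3.
    by apply/ratioE => //; have [] := base i.+2 ltac:(lia); rewrite subSS subn1 /=.
  by apply/ratioE => //; have [_] := base i.+2 ltac:(lia); rewrite subSS subn1 /=.
rewrite !subSS subn0 /=.
by split; apply/ratioE => //; try lia; [apply: rt | apply: rts]; lia.
Qed.

End DrinfeldOfSystem.

Section DrinfeldPolynomial.

Variables (F : fieldType) (Fbar : closedFieldType) (iota : {rmorphism F -> Fbar}).
Variables (V : vectType F) (d : nat) (beta : F).
Implicit Types Phi Psi : td_seq V d.

(** The Drinfel'd polynomial as a function of the system, with the canonical
    choice of alpha. *)
Definition drinfeld Phi : {poly F} :=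
  if type_of beta d is TypeIIIplus then
    \prod_(1 <= i < d.+1) p_factor_IIIplus Phi i
  else zeta_sum (alpha_of beta d) Phi.

Lemma is_drinfeld_polyP Phi Q : is_base Phi beta ->
  is_drinfeld_poly iota beta Phi Q <-> Q = drinfeld Phi.
Proof.
move=> base; rewrite /is_drinfeld_poly /drinfeld.
have sumP : type_of beta d <> TypeIIIplus ->
    (exists2 alpha : nat -> F, is_alpha iota beta d alpha & Q = zeta_sum alpha Phi) <->
    Q = zeta_sum (alpha_of beta d) Phi.
  move=> ty; split=> [[alpha al ->] | ->]; last first.
    by exists (alpha_of beta d) => //; apply: is_alpha_of.
  apply: eq_bigr => i _; congr (_ *: _); apply: eq_big_nat => j /andP[ij jd].
  by rewrite /p_factor (is_alpha_unique al) //; lia.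
case: (type_of beta d) sumP => sumP; last first;
  try by have {}sumP := sumP ltac:(discriminate); split=> [[_ /sumP] | /sumP].
by split=> [[]|].
Qed.

Lemma drinfeld_star Phi : tridiagonal_system Phi -> sharp Phi ->
  drinfeld (td_star Phi) = drinfeld Phi.
Proof.
move=> tdP shP; rewrite /drinfeld.
by case: (type_of beta d); first [exact: zeta_sum_star | exact: prod_IIIplus_star].
Qed.

Lemma drinfeld_Down Phi : tridiagonal_system Phi -> sharp Phi -> is_base Phi beta ->
  drinfeld (td_Down Phi) = drinfeld Phi.
Proof.
move=> tdP shP /(is_base_recurrent _ tdP)[b0 rt rts].
have t_inj : injective_upto d (theta Phi) := spectral_inj (spectral_of_td tdP).
have rt_inj : injective_upto d (reversal d (theta Phi)).
  by move=> i j id jd /t_inj e; have := e (leq_subr _ _) (leq_subr _ _); lia.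
rewrite /drinfeld.
have sumP : type_of beta d <> TypeIIIplus ->
    zeta_sum (alpha_of beta d) (td_Down Phi) = zeta_sum (alpha_of beta d) Phi.
  move=> ty; have [w sdata] := saalschutz_data_of_type (is_alpha_of iota ty) b0.
  apply: (zeta_sum_Down tdP shP (sdata _ _ rt rts t_inj)).
  by apply: sdata => //; apply: recurrent_reversal.
case E: (type_of beta d) sumP => sumP; try exact: sumP.
move: E; rewrite /type_of; case: ifP => // bI; case: ifP => // c2; case: ifP => // b2.
case: ifP => // /negbT d_even _.
have bE : beta = - 2 by move: bI; rewrite b2 => /negbFE/eqP.
rewrite bE in rt rts; apply: prod_IIIplus_Down => //.
by move: c2; rewrite inE => /negbT.
Qed.

Lemma is_base_star Phi : tridiagonal_system Phi -> is_base Phi beta ->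
  is_base (td_star Phi) beta.
Proof.
move=> tdP /(is_base_recurrent _ tdP)[b0 rt rts].
by apply/(is_base_recurrent _ (td_star_system tdP)).
Qed.

Lemma is_base_Down Phi : tridiagonal_system Phi -> is_base Phi beta ->
  is_base (td_Down Phi) beta.
Proof.
move=> tdP /(is_base_recurrent _ tdP)[b0 rt rts].
apply/(is_base_recurrent _ (td_Down_system tdP)); split=> // i id.
by rewrite !theta_Down; try lia; apply: recurrent_reversal rt _ id.
Qed.

Definition has_drinfeld (P : {poly F}) Psi :=
  [/\ tridiagonal_system Psi, sharp Psi, is_base Psi beta & drinfeld Psi = P].

Lemma has_drinfeld_star P Psi : has_drinfeld P Psi -> has_drinfeld P (td_star Psi).
Proof.
case=> tdP shP bP <-; split; [exact: td_star_system | exact: sharp_star |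
  exact: is_base_star | exact: drinfeld_star].
Qed.

Lemma has_drinfeld_Down P Psi : has_drinfeld P Psi -> has_drinfeld P (td_Down Psi).
Proof.
case=> tdP shP bP <-; split; [exact: td_Down_system | exact: sharp_Down |
  exact: is_base_Down | exact: drinfeld_Down].
Qed.

Lemma has_drinfeld_relative P Phi Psi :
  has_drinfeld P Phi -> relative Phi Psi -> has_drinfeld P Psi.
Proof.
move=> nP; elim=> [//|Psi' _|Psi' _|Psi' _] nPsi.
- exact: has_drinfeld_star.
- by rewrite td_down_conj; apply/has_drinfeld_star/has_drinfeld_Down/has_drinfeld_star.
exact: has_drinfeld_Down.
Qed.

End DrinfeldPolynomial.

Theorem theorem8p7
  (F : fieldType) (Fbar : closedFieldType) (iota : {rmorphism F -> Fbar})
  (Fbar_alg : forall x : Fbar, algebraicOver iota x)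
  (V : vectType F) (V_pos : (0 < \dim {:V})%N)
  (d : nat) (Phi : td_seq V d)
  (Phi_td : tridiagonal_system Phi) (Phi_sharp : sharp Phi)
  (beta : F) (beta_base : is_base Phi beta) :
  exists P : {poly F},
    forall Psi : td_seq V d, relative Phi Psi ->
      forall Q : {poly F}, is_drinfeld_poly iota beta Psi Q <-> Q = P.
Proof.
exists (drinfeld beta Phi) => Psi PhiPsi Q.
have [_ _ base <-] : has_drinfeld beta (drinfeld beta Phi) Psi.
  by apply: (has_drinfeld_relative iota _ PhiPsi).
exact: is_drinfeld_polyP.
Qed.
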